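(* Let $\alpha,\zeta$ be parameters with $\Re(\alpha)>0$ and $\Re(\zeta)>0$. Let $x_1$ and $x_2$ be statistically independently distributed real scalar positive random variables, where $x_1$ has the type-1 beta density with parameters $(\zeta,\alpha)$ and $x_2$ has an arbitrary density $f$ on $(0,\infty)$. Let $g$ denote the density of the ratio $u=\frac{x_2}{x_1}$. Then the Kober operator of the first kind applied to $f$, $$I_{u}^{\zeta,\alpha}f=\frac{u^{-\zeta-\alpha}}{\Gamma(\alpha)}\int_{0}^{u}(u-v)^{\alpha-1}v^{\zeta}f(v)\,dv,$$ satisfies $$I_{u}^{\zeta,\alpha}f=\frac{\Gamma(\zeta)}{\Gamma(\zeta+\alpha)}\,g(u)$$ for almost every $u>0$.
   Context: All densities are with respect to Lebesgue measure on $(0,\infty)$. The type-1 beta density with parameters $(\zeta,\alpha)$ is $$f_1(x)=\frac{\Gamma(\zeta+\alpha)}{\Gamma(\zeta)\Gamma(\alpha)}x^{\zeta-1}(1-x)^{\alpha-1},\quad 0<x<1,$$ and $f_1(x)=0$ elsewhere. In the statistical setting the parameters are real ($\alpha>0$, $\zeta>0$), and then $g$ is the actual probability density of $x_2/x_1$. For complex parameters, ''the density of $u=x_2/x_1$'' means the function given by the usual formula $$g(u)=\int_{0}^{\infty}f_1\left(\frac{v}{u}\right)f(v)\,\frac{v}{u^2}\,dv,\quad u>0.$$ *)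

(* Defs.v *)
From HB Require Import structures.
From mathcomp Require Import all_boot all_order all_algebra.
From mathcomp Require Import all_classical all_reals all_analysis.
From mathcomp Require Import complex.

Set Implicit Arguments.
Unset Strict Implicit.
Unset Printing Implicit Defensive.

Import Order.TTheory GRing.Theory Num.Theory.
Import numFieldNormedType.Exports.

Local Open Scope classical_set_scope.
Local Open Scope ring_scope.
Local Open Scope complex_scope.

Section complex_calculus.
Context {R : realType}.
Implicit Types (D : set R) (h : R -> R[i]) (w z : R[i]).

(* Principal value of x^w = exp (w ln x); meaningful for x > 0 only. *)
Definition cpow (x : R) w : R[i] :=
  (x `^ complex.Re w * cos (complex.Im w * ln x)) +i*
  (x `^ complex.Re w * sin (complex.Im w * ln x)).

Definition cintegrable D h : Prop :=
  (@lebesgue_measure R).-integrable D (fun x => (complex.Re (h x))%:E) /\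
  (@lebesgue_measure R).-integrable D (fun x => (complex.Im (h x))%:E).

(* Total: the value is meaningful only when [cintegrable D h] holds. *)
Definition cintegral D h : R[i] :=
  (\int[@lebesgue_measure R]_(x in D) complex.Re (h x)) +i*
  (\int[@lebesgue_measure R]_(x in D) complex.Im (h x)).

(* Euler's integral; used only for 0 < Re z, where it converges. *)
Definition Gamma z : R[i] :=
  cintegral `]0, +oo[ (fun t => cpow t (z - 1) * (expR (- t))%:C).

Definition beta1_density (zeta alpha : R[i]) (x : R) : R[i] :=
  if (0 < x) && (x < 1) then
    Gamma (zeta + alpha) / (Gamma zeta * Gamma alpha) *
    cpow x (zeta - 1) * cpow (1 - x) (alpha - 1)
  else 0.

Definition kober_integrand (zeta alpha : R[i]) (f : R -> R) (u v : R) : R[i] :=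
  cpow (u - v) (alpha - 1) * cpow v zeta * (f v)%:C.

Definition kober1 (zeta alpha : R[i]) (f : R -> R) (u : R) : R[i] :=
  cpow u (- zeta - alpha) / Gamma alpha *
  cintegral `]0, u[ (kober_integrand zeta alpha f u).

Definition ratio_integrand (f1 : R -> R[i]) (f : R -> R) (u v : R) : R[i] :=
  f1 (v / u) * (f v * (v / u ^+ 2))%:C.

(* g(u), for x1 with (possibly complex) density f1 and x2 with density f. *)
Definition ratio_density (f1 : R -> R[i]) (f : R -> R) (u : R) : R[i] :=
  cintegral `]0, +oo[ (ratio_integrand f1 f u).

End complex_calculus.

Section densities.
Context {R : realType}.

(* Only the values of f on (0, +oo) matter. *)
Definition is_density (f : R -> R) : Prop :=
  [/\ measurable_fun (`]0, +oo[ : set R) f,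
      forall x, 0 < x -> 0 <= f x &
      (\int[@lebesgue_measure R]_(x in `]0%R, +oo[) (f x)%:E = 1)%E].

(* The law of X is f(x) dx on (0, +oo); in particular X > 0 almost surely. *)
Definition has_density d (T : measurableType d) (P : probability T R)
    (X : T -> R) (f : R -> R) : Prop :=
  [/\ measurable_fun setT X, is_density f &
      forall B : set R, measurable B ->
        P (X @^-1` B) =
        (\int[@lebesgue_measure R]_(x in B `&` `]0%R, +oo[) (f x)%:E)%E].

Definition independent2 d (T : measurableType d) (P : probability T R)
    (X Y : T -> R) : Prop :=
  forall A B : set R, measurable A -> measurable B ->
    P (X @^-1` A `&` Y @^-1` B) = (P (X @^-1` A) * P (Y @^-1` B))%E.

End densities.

(* Main.v *)
Require Import Defs.
From HB Require Import structures.
From mathcomp Require Import all_boot all_order all_algebra.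
From mathcomp Require Import all_classical all_reals all_analysis.
From mathcomp Require Import complex.
From mathcomp Require Import ring lra.
From mathcomp Require Import measurable_realfun.

Set Implicit Arguments.
Unset Strict Implicit.
Unset Printing Implicit Defensive.

Import Order.TTheory GRing.Theory Num.Theory.
Import numFieldNormedType.Exports.

Local Open Scope classical_set_scope.
Local Open Scope ring_scope.
Local Open Scope complex_scope.
(** The Kober integral and the ratio integral have, up to a constant, the same
    integrand.  For [0 < v < u],
      [f1 (v / u) f(v) v / u^2 =
         K u^(- zeta - alpha) (u - v)^(alpha - 1) v^zeta f(v)],
    where [K = Gamma(zeta + alpha) / (Gamma zeta Gamma alpha)], because the
    powers of [u] released by [(v/u)^(zeta - 1)], [(1 - v/u)^(alpha - 1)] and
    [v / u^2] add up to [- zeta - alpha]; and [f1 (v / u)] vanishes for [v >= u]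
    ([ratio_integrandE], [ratio_integrand0]).  Multiplying by
    [Gamma zeta / Gamma (zeta + alpha)] leaves [1 / Gamma alpha], provided that
    the Gamma values cancel.  Three further facts make this a proof.

    The Gamma function has no zero in the right half-plane ([Gamma_neq0]).  By
    the functional equation a zero [a + i b] would make [Gamma] vanish at all
    [x + i b] with [x = a + n].  But for large [x] the Gamma weight
    [t^(x - 1) e^(- t)] concentrates near [t = x], where [t^(i b)] is close to
    [x^(i b)]: writing [G] for the real Gamma function,
      [Re (x^(- i b) Gamma(x + i b)) =
         int t^(x - 1) e^(- t) cos (b ln (t / x)) dt
         >= G(x - 1) (x - 1 - 2 b^2)],
    by [cos s >= 1 - s^2 / 2] and [(ln s)^2 <= 4 (s - 2 + 1/s)], since the
    resulting moments of the weight are [G(x)], [G(x + 1)] and [G(x - 1)]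
    ([gamma_wave_gt0]).

    For almost every [u] the Kober integrand is absolutely integrable
    ([ae_kober_integrable]).  Its modulus is bounded, for fixed [u], by a multiple
    of [k(u - v) f(v)], where [k] is a probability density on [(0, oo)] behaving
    like [t^(Re alpha - 1)] near [0]; by Tonelli the convolution of the densities
    [k] and [f] has total integral [1], so it is finite almost everywhere.

    For real parameters the formula for [g] gives the law of [x2 / x1]
    ([has_density_ratio]).  Independence makes the joint law a product, the
    substitution [x = y / u] at fixed [x2 = y] turns the law of [y / x1] into the
    density [f1 (y / u) y / u^2], and Tonelli integrates over [y].  Two densities
    of one law agree almost everywhere ([has_density_unique]), so the identity
    holds for every version of the density. *)

(** * Integration of derivatives over half-lines *)

Section ftc.
Context {R : realType}.
Notation mu := (@lebesgue_measure R).

(** The integrand may blow up at [v], as [t^(a - 1)] does at [0]: the half-line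
    is exhausted by closed half-lines starting at [v + 1/(n+1)]. *)
Lemma ge0_FTC_oy (f F : R -> R) (v l c : R) :
  (forall x, v < x -> 0 <= f x) ->
  (forall x, v < x -> {for x, continuous f}) ->
  (forall x, v < x -> is_derive x 1 F (f x)) ->
  F x @[x --> +oo] --> l -> F x @[x --> v^'+] --> c ->
  (\int[mu]_(x in `]v, +oo[) (f x)%:E = (l - c)%:E)%E.
Proof.
move=> f0 fc dF Fl Fc.
pose w n : R := v + n.+1%:R^-1.
have vw n : v < w n by rewrite /w ltrDl invr_gt0.
have mf : measurable_fun `]v, +oo[ f.
  apply: open_continuous_measurable_fun => // x.
  by rewrite inE/= in_itv/= andbT; exact: fc.
have -> : `]v, +oo[%classic = \bigcup_n `[w n, +oo[%classic :> set R.
  apply/seteqP; split=> x; last first.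
    by case=> n _ /=; rewrite !in_itv/= !andbT => /(lt_le_trans (vw n)).
  rewrite /= in_itv/= andbT => vx.
  have [n hn] : exists n : nat, n.+1%:R^-1 < x - v.
    have xv : 0 < x - v by rewrite subr_gt0.
    exists (Num.bound (x - v)^-1).
    rewrite invf_plt ?posrE// (lt_le_trans (archi_boundP _))// ?ler_nat//.
    by rewrite ltW ?invr_gt0.
  by exists n => //=; rewrite in_itv/= andbT /w addrC -lerBrDr ltW.
apply/esym.
have lim1 : (\int[mu]_(x in `[w n, +oo[) (f x)%:E)%E @[n --> \oo] -->
    (l - c)%:E.
  have intE n : (\int[mu]_(x in `[w n, +oo[) (f x)%:E)%E = (l - F (w n))%:E.
    rewrite EFinB; apply: ge0_continuous_FTC2y => //.
    - by move=> x wx; apply: f0; exact: lt_le_trans (vw n) wx.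
    - apply: continuous_in_subspaceT => x; rewrite inE/= in_itv/= andbT => wx.
      by apply: fc; exact: lt_le_trans (vw n) wx.
    - by move=> x wx; have := dF x (lt_trans (vw n) wx); case.
    - apply: cvg_at_right_filter; apply: differentiable_continuous.
      by apply/derivable1_diffP; have := dF _ (vw n); case.
    - move=> x; rewrite in_itv/= andbT => wx.
      by rewrite derive1E; have := dF x (lt_trans (vw n) wx); case=> _ ->.
  under eq_fun do rewrite intE.
  apply: cvg_EFin; first by apply: nearW.
  apply: cvgB; first exact: cvg_cst.
  move/cvg_at_rightP : Fc; apply; split=> //.
  rewrite -[X in _ --> X]addr0; apply: cvgD; first exact: cvg_cst.
  exact: cvg_harmonic.
apply: (cvg_unique _ lim1) => //.
apply: ge0_nondecreasing_set_cvg_integral.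
- move=> n m nm; apply/subsetPset; apply: subset_itvr.
  by rewrite bnd_simp /w lerD2l lef_pV2// ?posrE// ler_nat.
- by move=> i; exact: measurable_itv.
- move=> i; apply/measurable_EFinP; apply: measurable_funS mf => //.
  by apply: subset_itvr; rewrite bnd_simp.
- move=> i x /=; rewrite in_itv/= andbT lee_fin => wx.
  by apply: f0; exact: lt_le_trans (vw i) wx.
Qed.

End ftc.

(** * The log-logistic density *)

Section kernel.
Context {R : realType}.
Notation mu := (@lebesgue_measure R).

Lemma is_derive_continuous (h : R -> R) (x dh : R) :
  is_derive x 1 h dh -> {for x, continuous h}.
Proof.
by case=> dx _; apply: differentiable_continuous; exact/derivable1_diffP.
Qed.

Lemma continuous_powR (a x : R) : 0 < x -> {for x, continuous (@powR R ^~ a)}.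
Proof. by move=> x0; exact: is_derive_continuous (is_derive1_powR a x0). Qed.

Lemma cvgy_powR (a : R) : 0 < a -> (t `^ a)^-1 @[t --> +oo] --> (0 : R).
Proof.
move=> a0; apply/cvgrPdist_le => e e0; near=> t.
have t0 : 0 < t by near: t; exact: nbhs_pinfty_gt.
rewrite sub0r normrN ger0_norm ?invr_ge0 ?powR_ge0//.
rewrite invf_ple ?posrE ?powR_gt0//.
have ht : (e^-1) `^ a^-1 <= t by near: t; exact: nbhs_pinfty_ge.
have := ge0_ler_powR (ltW a0) (powR_ge0 _ _) (ltW t0) ht.
by rewrite -powRrM mulVf ?gt_eqF// powRr1// invr_ge0 ltW.
Unshelve. all: by end_near. Qed.

(** The log-logistic probability density of shape [a].  It behaves like
    [t^(a - 1)] at [0], decays polynomially, and has the elementary primitive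
    [- 1 / (1 + t^a)]; it serves as integrable majorant for every singular
    integrand below. *)
Definition loglogistic (a t : R) : R := a * t `^ (a - 1) / (1 + t `^ a) ^+ 2.

Lemma loglogistic_ge0 (a t : R) : 0 < a -> 0 <= loglogistic a t.
Proof.
by move=> a0; rewrite divr_ge0 ?sqr_ge0// mulr_ge0 ?powR_ge0// ltW.
Qed.

Lemma is_derive_loglogistic (a t : R) : 0 < t ->
  is_derive t 1 (fun t => - (1 + t `^ a)^-1) (loglogistic a t).
Proof.
move=> t0.
have n0 : 1 + t `^ a != 0 by rewrite gt_eqF// addr_gt0// powR_gt0.
have dp := is_derive1_powR a t0.
have d1 : is_derive t 1 (fun t => 1 + t `^ a) (a * t `^ (a - 1)).
  by rewrite -[X in is_derive _ _ _ X]add0r; apply: is_deriveD.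
have := is_deriveN (@is_deriveV _ (fun t => 1 + t `^ a) _ _ _ n0 d1).
by rewrite /GRing.scale/= mulNr opprK mulrC.
Qed.

Lemma continuous_loglogistic (a t : R) : 0 < t ->
  {for t, continuous (loglogistic a)}.
Proof.
move=> t0.
have n0 : 1 + t `^ a != 0 by rewrite gt_eqF// addr_gt0// powR_gt0.
rewrite /loglogistic; apply: continuousM.
  by apply: continuousM; [exact: cst_continuous|exact: continuous_powR].
apply: continuousV; first by rewrite expf_neq0.
have c1 : {for t, continuous (fun t => 1 + t `^ a)}.
  by apply: continuousD; [exact: cst_continuous|exact: continuous_powR].
exact: (continuousM c1 c1).
Qed.

Lemma cvg0_loglogistic (a : R) : 0 < a ->
  - (1 + t `^ a)^-1 @[t --> 0^'+] --> (-1 : R).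
Proof.
move=> a0; apply: cvgN; rewrite -[X in _ --> X]invr1; apply: cvgV => //.
by rewrite -[X in _ --> X]addr0; apply: cvgD; [exact: cvg_cst|exact: powR_cvg0].
Qed.

Lemma cvgy_loglogistic (a : R) : 0 < a ->
  - (1 + t `^ a)^-1 @[t --> +oo] --> (0 : R).
Proof.
move=> a0; rewrite -oppr0; apply: cvgN.
apply: (@squeeze_cvgr _ _ _ _ (cst 0) (fun t => (t `^ a)^-1)).
- near=> t; rewrite /= invr_ge0 addr_ge0 ?powR_ge0//=.
  have t0 : 0 < t by near: t; exact: nbhs_pinfty_gt.
  by rewrite lef_pV2 ?posrE ?addr_gt0 ?powR_gt0// lerDr.
- exact: cvg_cst.
- exact: cvgy_powR.
Unshelve. all: by end_near. Qed.

Lemma integral_loglogistic (a v : R) : 0 < a ->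
  (\int[mu]_(u in `]v, +oo[) (loglogistic a (u - v))%:E = 1)%E.
Proof.
move=> a0.
have -> : 1%E = (0 - (- 1) : R)%:E by rewrite sub0r opprK.
apply: (@ge0_FTC_oy _ _ (fun u => - (1 + (u - v) `^ a)^-1)).
- by move=> x _; exact: loglogistic_ge0.
- move=> x vx; apply: (@continuous_comp _ _ _ (fun u => u - v)).
    by apply: cvgB; [exact: cvg_id|exact: cvg_cst].
  by apply: continuous_loglogistic; rewrite subr_gt0.
- move=> x vx.
  rewrite -[loglogistic _ _]mulr1.
  apply: (@is_derive1_comp _ (fun t => - (1 + t `^ a)^-1) (fun u => u - v)).
    by apply: is_derive_loglogistic; rewrite subr_gt0.
  by rewrite -[X in is_derive _ _ _ X]subr0; apply: is_deriveB.
- by apply: cvg_comp (cvgy_loglogistic a0); exact: cvg_addrr.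
- apply/cvg_at_rightP => w [vw wv]; have /cvg_at_rightP := cvg0_loglogistic a0.
  apply; split=> [n|]; first by rewrite subr_gt0.
  by rewrite -(subrr v); apply: cvgB => //; exact: cvg_cst.
Qed.

End kernel.
Section gamma_bound.
Context {R : realType}.
Notation mu := (@lebesgue_measure R).

Lemma powR_le_expR (p t : R) : 0 <= p -> 0 < t -> t `^ p <= p `^ p * expR t.
Proof.
move=> p0 t0; have [->|pn0] := eqVneq p 0.
  by rewrite !powRr0 mul1r ltW// expR_gt1.
have {pn0}p0 : 0 < p by rewrite lt_neqAle eq_sym pn0.
have ht : t <= p * expR (t / p).
  rewrite -ler_pdivrMl// mulrC (le_trans _ (expR_ge1Dx _))//.
  by rewrite lerDr.
have := ge0_ler_powR (ltW p0) (ltW t0) (mulr_ge0 (ltW p0) (expR_ge0 _)) ht.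
move/le_trans; apply; rewrite powRM ?expR_ge0 ?(ltW p0)//.
by rewrite -expRM divfK ?gt_eqF.
Qed.

(** After division by [t^(a - 1)] the claim is that
    [t^r (1 + t^a)^2 e^(- t)] is bounded for [r = q - (a - 1) >= 0], which is
    [powR_le_expR] applied to the exponents [r] and [r + 2a]. *)
Lemma powR_expR_le_loglogistic (a q : R) : 0 < a -> a - 1 <= q ->
  exists2 C, 0 <= C & forall t, 0 < t ->
    t `^ q * expR (- t) <= C * loglogistic a t.
Proof.
move=> a0 aq; pose r := q - (a - 1).
have r0 : 0 <= r by rewrite subr_ge0.
pose s := r + (a + a).
have s0 : 0 <= s by do 2?[apply: addr_ge0 => //]; exact: ltW.
exists (a^-1 * (2 * r `^ r + 2 * s `^ s)).
  by rewrite mulr_ge0 ?invr_ge0 ?(ltW a0)// addr_ge0// mulr_ge0// powR_ge0.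
move=> t t0; have tn0 : t != 0 by rewrite gt_eqF.
have ta : 0 < 1 + t `^ a by rewrite addr_gt0// powR_gt0.
rewrite /loglogistic !mulrA ler_pdivlMr ?exprn_gt0//.
have -> : t `^ q = t `^ r * t `^ (a - 1).
  by rewrite -powRD ?tn0 ?implybT// /r subrK.
have key : t `^ r * (1 + t `^ a) ^+ 2 <= (2 * r `^ r + 2 * s `^ s) * expR t.
  have h1 := powR_le_expR r0 t0; have h2 := powR_le_expR s0 t0.
  have e : t `^ s = t `^ r * (t `^ a * t `^ a).
    by rewrite -!powRD ?tn0 ?implybT.
  rewrite e in h2.
  have : 0 <= t `^ r * (1 - t `^ a) ^+ 2 by rewrite mulr_ge0 ?powR_ge0 ?sqr_ge0.
  move: h1 h2; rewrite !expr2; move: (t `^ r) (t `^ a) (expR t) => x y z.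
  lra.
have := ler_wpM2r (mulr_ge0 (expR_ge0 (- t)) (powR_ge0 t (a - 1))) key.
have e1 := expRxMexpNx_1 t.
set D := 2 * _ + _; move: (1 + _) => E; move: (t `^ r) (t `^ (a - 1)) => x y.
have -> : a^-1 * D * a * y = D * y by field; rewrite gt_eqF.
have -> : D * expR t * (expR (- t) * y) = D * (expR t * expR (- t)) * y by ring.
rewrite e1 mulr1; apply: le_trans.
by rewrite le_eqVlt; apply/orP; left; apply/eqP; ring.
Qed.

End gamma_bound.

(** * Functional equation of the Gamma integral *)

Section mellin.
Context {R : realType}.
Notation mu := (@lebesgue_measure R).
Implicit Types a b p q t : R.

(** The combinations of the real and imaginary parts of [t^(i b)].  Keeping the
    coefficients [p] and [q] general lets one real integral carry both parts of
    [Gamma] as well as their rotations. *)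
Definition wave b p q t : R := p * cos (b * ln t) + q * sin (b * ln t).

Definition gamma_integrand a b p q t : R :=
  t `^ (a - 1) * wave b p q t * expR (- t).

Definition gamma_wave a b p q : R :=
  \int[mu]_(t in `]0, +oo[) gamma_integrand a b p q t.

Lemma norm_wave_le b p q t : `|wave b p q t| <= `|p| + `|q|.
Proof.
rewrite (le_trans (ler_normD _ _))// !normrM.
by rewrite lerD// ler_piMr// ?cos_max ?sin_max.
Qed.

Lemma is_derive1_congr (f g : R -> R) t df dg : is_derive t 1 f df ->
  f =1 g -> df = dg -> is_derive t 1 g dg.
Proof. by move=> + /funext <- <-. Qed.

Lemma is_derive_wave b p q t : 0 < t ->
  is_derive t 1 (wave b p q) (wave b (b * q) (- (b * p)) t / t).
Proof.
move=> t0; have dln := is_derive1_ln t0.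
have dbl : is_derive t 1 (fun t => b * ln t) (b / t).
  by have := @is_deriveZ _ _ _ (@ln R) b t 1 _ dln.
have dc := @is_derive1_comp _ cos (fun t => b * ln t) t _ _ (is_derive_cos _) dbl.
have ds := @is_derive1_comp _ sin (fun t => b * ln t) t _ _ (is_derive_sin _) dbl.
apply: (is_derive1_congr (is_deriveD (@is_deriveZ _ _ _ _ p t 1 _ dc)
  (@is_deriveZ _ _ _ _ q t 1 _ ds))) => //.
by rewrite /wave /GRing.scale/=; ring.
Qed.

Lemma is_derive_gamma_primitive a b p q t : 0 < t ->
  is_derive t 1 (fun t => t `^ a * wave b p q t * expR (- t))
    (gamma_integrand a b (a * p + b * q) (a * q - b * p) t -
     gamma_integrand (a + 1) b p q t).
Proof.
move=> t0.
have dp := is_derive1_powR a t0; have dw := is_derive_wave b p q t0.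
have de : is_derive t 1 (fun t => expR (- t)) (- expR (- t)).
  apply: (is_derive1_congr (@is_derive1_comp _ expR (fun t => - t) t _ (- 1)
    (is_derive_expR _) _)) => //; last by rewrite mulrN1.
apply: (is_derive1_congr (is_deriveM (is_deriveM dp dw) de)) => //.
have tE : t `^ a = t `^ (a - 1) * t.
  by rewrite -[X in _ * X]powRr1 ?ltW// -powRD ?subrK// (gt_eqF t0) implybT.
rewrite /gamma_integrand addrK /GRing.scale/= !fctE tE /wave; field.
by rewrite gt_eqF.
Qed.

Lemma continuous_gamma_integrand a b p q t : 0 < t ->
  {for t, continuous (gamma_integrand a b p q)}.
Proof.
move=> t0; rewrite /gamma_integrand.
exact: is_derive_continuous (is_derive_gamma_primitive (a - 1) b p q t0).
Qed.

Lemma gamma_integrand_le_loglogistic a b p q k : 0 < k -> k <= a ->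
  exists2 C, 0 <= C & forall t, 0 < t ->
    `|gamma_integrand a b p q t| <= C * loglogistic k t.
Proof.
move=> k0 ka.
have [|C C0 hC] := @powR_expR_le_loglogistic _ k (a - 1) k0; first by rewrite lerD2r.
exists ((`|p| + `|q|) * C); first by rewrite mulr_ge0// addr_ge0.
move=> t t0; rewrite /gamma_integrand mulrAC mulrC normrM -mulrA ler_pM//.
  exact: norm_wave_le.
by rewrite ger0_norm ?mulr_ge0 ?powR_ge0 ?expR_ge0// hC.
Qed.

Lemma integrable_loglogistic k : 0 < k ->
  mu.-integrable `]0, +oo[ (EFin \o loglogistic k).
Proof.
move=> k0; apply/integrableP; split.
  apply/measurable_EFinP; apply: open_continuous_measurable_fun => // x.
  by rewrite inE/= in_itv/= andbT; exact: continuous_loglogistic.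
suff -> : (\int[mu]_(x in `]0%R, +oo[) `|(EFin \o loglogistic k) x| =
          \int[mu]_(x in `]0%R, +oo[) (loglogistic k (x - 0))%:E)%E.
  by rewrite integral_loglogistic// ltry.
by apply: eq_integral => x _; rewrite subr0/= ger0_norm ?loglogistic_ge0.
Qed.

Lemma integrable_loglogistic_dominated (h : R -> R) a C : 0 < a ->
  (forall t, 0 < t -> {for t, continuous h}) ->
  (forall t, 0 < t -> `|h t| <= C * loglogistic a t) ->
  mu.-integrable `]0, +oo[ (EFin \o h).
Proof.
move=> a0 ch hC; apply: (@le_integrable _ _ _ mu _ _ _
  (fun t : R => C%:E * (loglogistic a t)%:E)%E) => //.
- apply/measurable_EFinP; apply: open_continuous_measurable_fun => // x.
  by rewrite inE/= in_itv/= andbT; exact: ch.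
- move=> t /=; rewrite in_itv/= andbT => t0.
  by rewrite lee_fin (le_trans (hC t t0))// ler_norm.
- by apply: integrableZl => //; exact: integrable_loglogistic.
Qed.

Lemma integrable_gamma_integrand a b p q : 0 < a ->
  mu.-integrable `]0, +oo[ (EFin \o gamma_integrand a b p q).
Proof.
move=> a0.
have [C C0 hC] := @gamma_integrand_le_loglogistic a b p q a a0 (lexx _).
by apply: integrable_loglogistic_dominated a0 _ hC => t;
  exact: continuous_gamma_integrand.
Qed.

(** [h] has no sign, but [h + C * loglogistic a] is nonnegative, so the
    nonnegative case applies to it; the integral of the added term is [C]. *)
Lemma FTC_oy_dominated (H h : R -> R) a C : 0 < a ->
  (forall t, 0 < t -> is_derive t 1 H (h t)) ->
  (forall t, 0 < t -> {for t, continuous h}) ->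
  (forall t, 0 < t -> `|h t| <= C * loglogistic a t) ->
  H t @[t --> +oo] --> (0 : R) -> H t @[t --> 0^'+] --> (0 : R) ->
  \int[mu]_(t in `]0, +oo[) h t = 0.
Proof.
move=> a0 dH ch hC Hy H0.
have ih : mu.-integrable `]0, +oo[ (EFin \o h).
  exact: integrable_loglogistic_dominated hC.
have ik := integrable_loglogistic a0.
have E : (\int[mu]_(t in `]0%R, +oo[) (h t + C * loglogistic a t)%:E =
    ((0 + C * 0) - (0 + C * (- 1)))%:E)%E.
  apply: (@ge0_FTC_oy _ _ (fun t => H t + C * (- (1 + t `^ a)^-1))).
  - move=> t t0; have := hC t t0; rewrite ler_norml => /andP[+ _].
    by rewrite lerNl -subr_ge0 opprK addrC.
  - move=> t t0; apply: cvgD; first exact: ch.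
    by apply: cvgM; [exact: cvg_cst|exact: continuous_loglogistic].
  - move=> t t0; have dk := is_derive_loglogistic a t0.
    exact: is_deriveD (dH t t0) (@is_deriveZ _ _ _ _ C t 1 _ dk).
  - by apply: cvgD => //; apply: cvgM; [exact: cvg_cst|exact: cvgy_loglogistic].
  - by apply: cvgD => //; apply: cvgM; [exact: cvg_cst|exact: cvg0_loglogistic].
have k1 : (\int[mu]_(t in `]0%R, +oo[) (loglogistic a t)%:E = 1)%E.
  rewrite -(integral_loglogistic 0 a0).
  by apply: eq_integral => x _; rewrite subr0.
move: E; under eq_integral do rewrite EFinD EFinM.
rewrite integralD//=; last by apply: integrableZl.
rewrite integralZl// k1 mule1 mulr0 !add0r mulrN1 opprK => E.
have := @integrable_fin_num _ _ _ mu _ (measurable_itv _) _ ih.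
move: E; rewrite /Rintegral /=.
case: (integral _ _ _) => //= r [] rC _; lra.
Qed.

Lemma cvg0_gamma_primitive a b p q : 0 < a ->
  t `^ a * wave b p q t * expR (- t) @[t --> 0^'+] --> (0 : R).
Proof.
move=> a0; apply/norm_cvg0P.
apply: (@squeeze_cvgr _ _ _ _ (cst 0) (fun t => (`|p| + `|q|) * t `^ a)).
- near=> t; have t0 : 0 < t by near: t; exact: nbhs_right_gt.
  rewrite normr_ge0/= !normrM mulrAC [X in _ <= X]mulrC ler_pM ?mulr_ge0//.
    rewrite !ger0_norm ?powR_ge0 ?expR_ge0// ler_piMr ?powR_ge0//.
    by rewrite expR_le1 oppr_le0 ltW.
  exact: norm_wave_le.
- exact: cvg_cst.
- rewrite -[X in _ --> X](mulr0 (`|p| + `|q|)); apply: cvgM; first exact: cvg_cst.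
  exact: powR_cvg0.
Unshelve. all: by end_near. Qed.

Lemma cvgy_gamma_primitive a b p q : 0 < a ->
  t `^ a * wave b p q t * expR (- t) @[t --> +oo] --> (0 : R).
Proof.
move=> a0; apply/norm_cvg0P.
pose C := (`|p| + `|q|) * (a + 1) `^ (a + 1).
apply: (@squeeze_cvgr _ _ _ _ (cst 0) (fun t => C * (t `^ 1)^-1)).
- near=> t; have t0 : 0 < t by near: t; exact: nbhs_pinfty_gt.
  rewrite normr_ge0/= !normrM mulrAC mulrC /C -mulrA ler_pM ?mulr_ge0//.
    exact: norm_wave_le.
  rewrite !ger0_norm ?powR_ge0 ?expR_ge0// ler_pdivlMr ?powR_gt0//.
  have a1 : 0 <= a + 1 by rewrite addr_ge0// ltW.
  have := powR_le_expR a1 t0.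
  rewrite powRD ?(gt_eqF t0) ?implybT// => /(ler_wpM2r (expR_ge0 (- t))).
  by rewrite -(mulrA _ (expR t)) expRxMexpNx_1 mulr1 mulrAC.
- exact: cvg_cst.
- rewrite -[X in _ --> X](mulr0 C); apply: cvgM; first exact: cvg_cst.
  exact: cvgy_powR.
Unshelve. all: by end_near. Qed.

(** The functional equation [Gamma (z + 1) = z Gamma z]: on the coefficients
    [(p, q)], multiplication by [z = a + i b] acts as
    [(p, q) |-> (a p + b q, a q - b p)].  The difference of the two integrands is
    the derivative of [t^a * wave b p q t * e^(- t)], which vanishes at both
    ends. *)
Lemma gamma_waveS a b p q : 0 < a ->
  gamma_wave (a + 1) b p q = gamma_wave a b (a * p + b * q) (a * q - b * p).
Proof.
move=> a0; apply/esym/eqP; rewrite -subr_eq0; apply/eqP.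
have aS : 0 < a + 1 by rewrite addr_gt0.
rewrite /gamma_wave -RintegralB//; [|exact: integrable_gamma_integrand..].
have [C1 C10 h1] := @gamma_integrand_le_loglogistic a b
  (a * p + b * q) (a * q - b * p) a a0 (lexx _).
have aleS : a <= a + 1 by rewrite lerDl.
have [C2 C20 h2] := @gamma_integrand_le_loglogistic (a + 1) b p q a a0 aleS.
apply: (@FTC_oy_dominated (fun t => t `^ a * wave b p q t * expR (- t))
  _ a (C1 + C2)) => //.
- by move=> t t0; exact: is_derive_gamma_primitive.
- by move=> t t0; apply: cvgB; exact: continuous_gamma_integrand.
- move=> t t0; rewrite (le_trans (ler_normB _ _))// mulrDl.
  by rewrite lerD ?h1 ?h2.
- exact: cvgy_gamma_primitive.
- exact: cvg0_gamma_primitive.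
Qed.

End mellin.

(** * Non-vanishing of the Gamma function on the right half-plane *)

Section nonvanishing.
Context {R : realType}.
Notation mu := (@lebesgue_measure R).
Implicit Types a b p q t x y : R.

Lemma norm_sin_le x : `|sin x| <= `|x|.
Proof.
wlog x0 : x / 0 <= x => [H|].
  have [|x0] := leP 0 x; first exact: H.
  by rewrite -normrN -sinN -[`|x|]normrN H// oppr_ge0 ltW.
have [|c _] := @MVT_segment _ sin cos 0 x x0 (fun y _ => is_derive_sin y).
  by apply: continuous_subspaceT; exact: continuous_sin.
by rewrite sin0 !subr0 => ->; rewrite normrM ler_piMl// cos_max.
Qed.

Lemma cos_ge_quadratic x : 1 - x ^+ 2 / 2 <= cos x.
Proof.
have -> : cos x = 1 - 2 * sin (x / 2) ^+ 2.
  rewrite [in LHS](_ : x = x / 2 + x / 2); last by field.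
  rewrite cosD -!expr2 cos2sin2; ring.
have h : sin (x / 2) ^+ 2 <= (x / 2) ^+ 2.
  rewrite -[leLHS]real_normK ?num_real// -[leRHS]real_normK ?num_real//.
  by rewrite lerXn2r ?nnegrE ?norm_sin_le.
rewrite (_ : (x / 2) ^+ 2 = x ^+ 2 / 4) in h; last by field.
lra.
Qed.

(** With [x = r^2] the right-hand side is [4 (r - 1/r)^2], and
    [|r - 1/r| >= |ln r|] because [e^s >= 1 + s] bounds [r] and [1/r]. *)
Lemma sqr_ln_le x : 0 < x -> (ln x) ^+ 2 <= 4 * (x - 2 + x^-1).
Proof.
move=> x0; set w := ln x; pose r := expR (w / 2).
have r0 : 0 < r by exact: expR_gt0.
have xE : x = r * r by rewrite -expRD -splitr lnK.
have h1 : 1 + w / 2 <= r by exact: expR_ge1Dx.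
have h2 : 1 - w / 2 <= r^-1 by rewrite -expRN; exact: expR_ge1Dx.
have h3 : (w / 2) ^+ 2 <= (r - r^-1) ^+ 2.
  rewrite -[leLHS]real_normK ?num_real// -[leRHS]real_normK ?num_real//.
  rewrite lerXn2r ?nnegrE//.
  have [w0|w0] := leP 0 w.
    have hr : r^-1 <= 1 by rewrite invf_le1//; lra.
    have hw : 0 <= w / 2 by lra.
    have hd : w / 2 <= r - r^-1 by lra.
    by rewrite !ger0_norm// (le_trans hw).
  have hr : r <= 1 by rewrite -[r]invrK invf_le1 ?invr_gt0//; lra.
  have hw : w / 2 <= 0 by lra.
  have hd : r - r^-1 <= w / 2 by lra.
  by rewrite !ler0_norm ?lerN2// (le_trans hd).
have -> : w ^+ 2 = 4 * (w / 2) ^+ 2 by field.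
rewrite ler_pM2l// (le_trans h3)// xE le_eqVlt; apply/orP; left; apply/eqP.
by field; rewrite gt_eqF.
Qed.

Lemma gamma_wave_linear a b p q : 0 < a ->
  gamma_wave a b p q = p * gamma_wave a b 1 0 + q * gamma_wave a b 0 1.
Proof.
move=> a0; have i1 := integrable_gamma_integrand b 1 0 a0.
have i2 := integrable_gamma_integrand b 0 1 a0.
rewrite /gamma_wave -RintegralZl// -RintegralZl// -RintegralD//; last 2 first.
- by apply: (@integrableZl _ _ _ mu _ _ p _ i1).
- by apply: (@integrableZl _ _ _ mu _ _ q _ i2).
by apply: eq_Rintegral => t _; rewrite /gamma_integrand /wave; ring.
Qed.

Definition real_gamma x := gamma_wave x 0 1 0.

Lemma real_gamma_integrandE x t :
  gamma_integrand x 0 1 0 t = t `^ (x - 1) * expR (- t).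
Proof. by rewrite /gamma_integrand /wave !mul0r cos0 mulr1 addr0 mulr1. Qed.

Lemma real_gammaS x : 0 < x -> real_gamma (x + 1) = x * real_gamma x.
Proof.
move=> x0; rewrite /real_gamma gamma_waveS// gamma_wave_linear//.
by rewrite mulr1 !mul0r addr0 mulr0 subr0 mul0r addr0.
Qed.

(** On [[1, 2]] the integrand is at least [e^(-2)], as [t^(x - 1) >= 1] there. *)
Lemma real_gamma_gt0 x : 1 <= x -> 0 < real_gamma x.
Proof.
move=> x1; have x0 := lt_le_trans ltr01 x1.
have ig := integrable_gamma_integrand 0 1 0 x0.
rewrite [real_gamma x](_ : _ =
  fine (\int[mu]_(t in `]0%R, +oo[) (gamma_integrand x 0 1 0 t)%:E)%E)//.
have mig := measurable_int _ ig.
have sub12 : (`[1%R, 2%R]%classic : set R) `<=` `]0%R, +oo[%classic.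
  by move=> t/=; rewrite !in_itv/= andbT => /andP[+ _]; exact: lt_le_trans.
have h : ((expR (-2))%:E <=
    \int[mu]_(t in `]0%R, +oo[) (gamma_integrand x 0 1 0 t)%:E)%E.
  apply: (@le_trans _ _
    (\int[mu]_(t in `[1%R, 2%R]) (gamma_integrand x 0 1 0 t)%:E)%E).
    apply: (@le_trans _ _ (\int[mu]_(t in `[1%R, 2%R]) (expR (-2))%:E)%E).
      rewrite integral_cst//= lebesgue_measure_itv/= lte_fin ltr1n -EFinD -EFinM.
      by rewrite lee_fin; lra.
    apply: ge0_le_integral => //.
    - exact: measurable_funS mig.
    - move=> t /=; rewrite in_itv/= => /andP[t1 t2].
      rewrite lee_fin real_gamma_integrandE.
      rewrite -[leLHS]mul1r ler_pM ?expR_ge0//; last by rewrite ler_expR lerN2.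
      apply: (@le_trans _ _ (1 `^ (x - 1))); first by rewrite powR1.
      by apply: ge0_ler_powR; rewrite ?subr_ge0 ?nnegrE// (le_trans _ t1).
  apply: ge0_subset_integral => //= t _.
  by rewrite lee_fin real_gamma_integrandE mulr_ge0 ?powR_ge0 ?expR_ge0.
rewrite fine_gt0//; apply/andP; split.
  by apply: lt_le_trans h; rewrite lte_fin expR_gt0.
have := @integrable_fin_num _ _ _ mu _ (measurable_itv _) _ ig.
by rewrite fin_numE ltey => /andP[].
Qed.

(** The quantity is the real part of [x^(- i b) Gamma (x + i b)], with integrand
    [t^(x - 1) e^(- t) cos (b ln (t / x))].  The cosine is at least
    [1 - 2 b^2 (t/x - 2 + x/t)], whose integral against the Gamma weight is, by
    the functional equation, [real_gamma (x - 1) * (x - 1 - 2 b^2)]. *)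
Lemma gamma_wave_gt0 x b : 2 + 2 * b ^+ 2 <= x ->
  0 < gamma_wave x b (cos (b * ln x)) (sin (b * ln x)).
Proof.
move=> hx; have b0 := sqr_ge0 b.
have x0 : 0 < x by lra.
have y0 : 0 < x - 1 by lra.
have xS0 : 0 < x + 1 by lra.
have g0 : 0 < real_gamma (x - 1) by apply: real_gamma_gt0; lra.
have x2b : 0 < x - 1 - 2 * b ^+ 2 by lra.
have gx : real_gamma x = (x - 1) * real_gamma (x - 1).
  by have := real_gammaS y0; rewrite subrK.
have gSx := real_gammaS x0.
have i0 := integrable_gamma_integrand 0 1 0 x0.
have iS := integrable_gamma_integrand 0 1 0 xS0.
have ip := integrable_gamma_integrand 0 1 0 y0.
(* coefficients of [1], [t] and [1/t] in [1 - 2 b^2 (t/x - 2 + x/t)] *)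
pose c0 := 1 + 4 * b ^+ 2; pose c1 := - (2 * b ^+ 2 / x).
pose c2 := - (2 * b ^+ 2 * x).
have j0 : mu.-integrable `]0, +oo[ (EFin \o (fun t =>
    c0 * gamma_integrand x 0 1 0 t)).
  by apply: (@integrableZl _ _ _ mu _ _ c0 _ i0).
have jS : mu.-integrable `]0, +oo[ (EFin \o (fun t =>
    c1 * gamma_integrand (x + 1) 0 1 0 t)).
  by apply: (@integrableZl _ _ _ mu _ _ c1 _ iS).
have jp : mu.-integrable `]0, +oo[ (EFin \o (fun t =>
    c2 * gamma_integrand (x - 1) 0 1 0 t)).
  by apply: (@integrableZl _ _ _ mu _ _ c2 _ ip).
have j0S : mu.-integrable `]0, +oo[ (EFin \o (fun t =>
    c0 * gamma_integrand x 0 1 0 t + c1 * gamma_integrand (x + 1) 0 1 0 t)).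
  by apply: (integrableD _ j0 jS).
have j : mu.-integrable `]0, +oo[ (EFin \o (fun t =>
    c0 * gamma_integrand x 0 1 0 t + c1 * gamma_integrand (x + 1) 0 1 0 t +
    c2 * gamma_integrand (x - 1) 0 1 0 t)).
  by apply: (integrableD _ j0S jp).
apply: (@lt_le_trans _ _ (c0 * real_gamma x + c1 * real_gamma (x + 1) +
    c2 * real_gamma (x - 1))).
  rewrite gSx gx /c0 /c1 /c2.
  rewrite (_ : _ + _ = real_gamma (x - 1) * (x - 1 - 2 * b ^+ 2)).
    exact: mulr_gt0.
  by field; rewrite gt_eqF.
rewrite /real_gamma /gamma_wave -!RintegralZl// -!RintegralD//.
apply: le_Rintegral => //; first exact: integrable_gamma_integrand.
move=> t /=; rewrite in_itv/= andbT => t0.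
rewrite !real_gamma_integrandE /gamma_integrand.
have tx0 : 0 < t / x by rewrite divr_gt0.
have tE y : t `^ (y + 1) = t `^ y * t.
  by rewrite powRD ?(gt_eqF t0) ?implybT// powRr1// ltW.
have -> : t `^ (x + 1 - 1) = t `^ (x - 1 - 1) * t * t.
  by rewrite -!tE; congr (_ `^ _); ring.
have -> : t `^ (x - 1) = t `^ (x - 1 - 1) * t by rewrite -tE subrK.
have wE : 1 - b ^+ 2 * (2 * (t / x - 2 + x / t)) <=
    wave b (cos (b * ln x)) (sin (b * ln x)) t.
  have -> : wave b (cos (b * ln x)) (sin (b * ln x)) t = cos (b * ln (t / x)).
    by rewrite ln_div ?posrE// mulrBr cosB /wave; ring.
  apply: le_trans (cos_ge_quadratic _); rewrite lerD2l lerN2 exprMn -mulrA.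
  apply: ler_wpM2l => //; rewrite ler_pdivrMr// (le_trans (sqr_ln_le tx0))//.
  by rewrite invf_div le_eqVlt; apply/orP; left; apply/eqP; ring.
have := ler_wpM2r (mulr_ge0 (mulr_ge0 (powR_ge0 t (x - 1 - 1)) (ltW t0))
  (expR_ge0 (- t))) wE.
move: (t `^ _) (wave _ _ _ _) (expR _) => P W E /le_trans h.
rewrite [leRHS](_ : _ = W * (P * t * E)); last by ring.
apply: le_trans; last exact: (h _ (lexx _)).
rewrite le_eqVlt; apply/orP; left; apply/eqP; rewrite /c0 /c1 /c2; field.
by rewrite !gt_eqF.
Qed.

Lemma Gamma_waveE a b :
  Gamma (a +i* b) = gamma_wave a b 1 0 +i* gamma_wave a b 0 1.
Proof.
rewrite /Gamma /cintegral /gamma_wave.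
congr (_ +i* _); apply: eq_Rintegral => t _; rewrite /gamma_integrand /wave/=.
  by rewrite !mul1r !mul0r subr0 mulr0 subr0 addr0.
by rewrite !mul1r !mul0r subr0 mulr0 add0r add0r.
Qed.

(** If [Gamma (a + i b) = 0] then all the integrals [gamma_wave a b p q] vanish,
    and the functional equation propagates this to [a + n], where it contradicts
    [gamma_wave_gt0] for large [n]. *)
Lemma Gamma_neq0 (z : R[i]) : 0 < complex.Re z -> Gamma z != 0.
Proof.
case: z => a b /= a0; apply/eqP; rewrite Gamma_waveE => G0.
have g1 : gamma_wave a b 1 0 = 0.
  by rewrite -[LHS]/(complex.Re (_ +i* gamma_wave a b 0 1)) G0.
have g2 : gamma_wave a b 0 1 = 0.
  by rewrite -[LHS]/(complex.Im (gamma_wave a b 1 0 +i* _)) G0.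
have gn n p q : gamma_wave (a + n%:R) b p q = 0.
  elim: n p q => [|n IH] p q.
    by rewrite addr0 gamma_wave_linear// g1 g2 !mulr0 addr0.
  by rewrite -natr1 addrA gamma_waveS ?IH// ltr_wpDr.
pose n := Num.bound (2 + 2 * b ^+ 2).
have := @gamma_wave_gt0 (a + n%:R) b.
rewrite gn ltxx => /(_ _)/negP; apply => //.
rewrite ltW// ltr_wpDl//; first exact: ltW.
by apply: archi_boundP; rewrite addr_ge0// mulr_ge0// sqr_ge0.
Qed.

End nonvanishing.

(** * Complex powers and the common integrand *)

Section cpow.
Context {R : realType}.
Implicit Types (x y t : R) (w z : R[i]).

Lemma cpowE x w : cpow x w = (x `^ complex.Re w)%:C *
  (cos (complex.Im w * ln x) +i* sin (complex.Im w * ln x)).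
Proof. by rewrite /cpow; apply/eqP; rewrite eq_complex/= !mul0r subr0 addr0 !eqxx. Qed.

Lemma cisD x y :
  (cos (x + y) +i* sin (x + y)) = (cos x +i* sin x) * (cos y +i* sin y).
Proof.
apply/eqP; rewrite eq_complex/= cosD sinD.
by apply/andP; split; apply/eqP; ring.
Qed.

Lemma cpowM x y w : 0 < x -> 0 < y -> cpow (x * y) w = cpow x w * cpow y w.
Proof.
move=> x0 y0; rewrite !cpowE powRM ?ltW// lnM ?posrE// mulrDr cisD rmorphM/=.
by rewrite mulrACA.
Qed.

Lemma cpowD x w z : 0 < x -> cpow x (w + z) = cpow x w * cpow x z.
Proof.
case: w z => [a b] [c d] x0; rewrite !cpowE/= powRD ?(gt_eqF x0) ?implybT//.
by rewrite mulrDl cisD rmorphM/= mulrACA.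
Qed.

Lemma cpow1 x : 0 < x -> cpow x 1 = x%:C.
Proof. by move=> x0; rewrite cpowE/= powRr1 ?ltW// mul0r cos0 sin0 mulr1. Qed.

Lemma cpowV x w : 0 < x -> cpow x^-1 w = cpow x (- w).
Proof.
move=> x0; have x0' : 0 < x^-1 by rewrite invr_gt0.
rewrite !cpowE; case: w => a b/=.
by rewrite lnV ?posrE// mulrN mulNr -powR_inv1 ?ltW// -powRrM mulN1r.
Qed.

(** The powers of [u] on the left are [1 - zeta] from [(v/u)^(zeta - 1)],
    [1 - alpha] from [((u - v)/u)^(alpha - 1)] and [-2] from [v / u^2]. *)
Lemma ratio_integrandE zeta alpha (f : R -> R) (u v : R) : 0 < v < u ->
  ratio_integrand (beta1_density zeta alpha) f u v =
  (Gamma (zeta + alpha) / (Gamma zeta * Gamma alpha) * cpow u (- zeta - alpha)) *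
  kober_integrand zeta alpha f u v.
Proof.
move=> /andP[v0 vu]; have u0 := lt_trans v0 vu.
have uv0 : 0 < u - v by rewrite subr_gt0.
have ui0 : 0 < u^-1 by rewrite invr_gt0.
rewrite /ratio_integrand /beta1_density divr_gt0// ltr_pdivrMr// mul1r vu/=.
rewrite /kober_integrand; set K := Gamma _ / _.
have -> : 1 - v / u = (u - v) / u by rewrite mulrBl divff// gt_eqF.
rewrite !cpowM// !cpowV//.
have -> : (f v * (v / u ^+ 2))%:C = (f v)%:C * (cpow v 1 * (cpow u (- 1) * cpow u (- 1))).
  rewrite -!cpowV// !cpow1// -!rmorphM/=; congr (_%:C).
  by rewrite expr2 invfM.
have -> : cpow v zeta = cpow v (zeta - 1) * cpow v 1 by rewrite -cpowD// subrK.
have -> : cpow u (- zeta - alpha) =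
    cpow u (- (zeta - 1)) * cpow u (- (alpha - 1)) * cpow u (- 1) * cpow u (- 1).
  by rewrite -!cpowD//; congr cpow; ring.
ring.
Qed.

Lemma ratio_integrand0 zeta alpha (f : R -> R) (u v : R) : 0 < u -> u <= v ->
  ratio_integrand (beta1_density zeta alpha) f u v = 0.
Proof.
move=> u0 uv; rewrite /ratio_integrand /beta1_density.
by rewrite ltr_pdivrMr// mul1r (ltNge v u) uv andbF mul0r.
Qed.

End cpow.

Section cintegral.
Context {R : realType}.
Notation mu := (@lebesgue_measure R).
Implicit Types (D : set R) (h : R -> R[i]) (c : R[i]).

Lemma cintegrableZ D h c : measurable D ->
  cintegrable D h -> cintegrable D (fun x => c * h x).
Proof.
move=> mD [h1 h2]; case: c => a b; split.
  apply: (@eq_integrable _ _ _ mu D mD (fun x =>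
    a%:E * (complex.Re (h x))%:E - b%:E * (complex.Im (h x))%:E)%E).
    by move=> x _; case: (h x) => ? ?.
  by apply: integrableB => //; apply: integrableZl.
apply: (@eq_integrable _ _ _ mu D mD (fun x =>
  a%:E * (complex.Im (h x))%:E + b%:E * (complex.Re (h x))%:E)%E).
  by move=> x _; case: (h x) => ? ?.
by apply: integrableD => //; apply: integrableZl.
Qed.

Lemma cintegralZ D h c : measurable D -> cintegrable D h ->
  cintegral D (fun x => c * h x) = c * cintegral D h.
Proof.
move=> mD [h1 h2]; case: c => a b; rewrite /cintegral.
apply/eqP; rewrite eq_complex/=; apply/andP; split; apply/eqP.
  rewrite -!RintegralZl// -RintegralB//=; last 2 first.
  - by apply: (@integrableZl _ _ _ mu _ _ a _ h1).
  - by apply: (@integrableZl _ _ _ mu _ _ b _ h2).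
  by apply: eq_Rintegral => x _; case: (h x).
rewrite -!RintegralZl// -RintegralD//=; last 2 first.
- by apply: (@integrableZl _ _ _ mu _ _ a _ h2).
- by apply: (@integrableZl _ _ _ mu _ _ b _ h1).
by apply: eq_Rintegral => x _; case: (h x).
Qed.

Lemma eq_cintegrable D h k : measurable D -> {in D, h =1 k} ->
  cintegrable D h -> cintegrable D k.
Proof.
move=> mD hk [h1 h2]; split.
  by apply: eq_integrable h1 => // x /hk ->.
by apply: eq_integrable h2 => // x /hk ->.
Qed.

Lemma eq_cintegral D h k : {in D, h =1 k} -> cintegral D h = cintegral D k.
Proof.
by move=> hk; congr (_ +i* _); apply: eq_Rintegral => x /hk ->.
Qed.

Lemma cintegrable_support D E h : measurable D -> measurable E -> D `<=` E ->
  (forall x, E x -> ~ D x -> h x = 0) -> cintegrable D h -> cintegrable E h.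
Proof.
move=> mD mE DE h0 [h1 h2]; split.
  have := (@integrable_mkcond _ _ _ mu D _ mD).1 h1.
  move=> /(@integrableS _ _ _ mu _ _ _ measurableT mE (@subsetT _ _)).
  apply: eq_integrable => // x; rewrite inE => Ex; rewrite patchE; case: ifPn => //.
  by rewrite notin_setE => /(h0 _ Ex) ->.
have := (@integrable_mkcond _ _ _ mu D _ mD).1 h2.
move=> /(@integrableS _ _ _ mu _ _ _ measurableT mE (@subsetT _ _)).
apply: eq_integrable => // x; rewrite inE => Ex; rewrite patchE; case: ifPn => //.
by rewrite notin_setE => /(h0 _ Ex) ->.
Qed.

Lemma cintegral_support D E h : measurable D -> measurable E -> D `<=` E ->
  (forall x, E x -> ~ D x -> h x = 0) -> cintegral E h = cintegral D h.
Proof.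
move=> mD mE DE h0; rewrite -[D](setIidr DE) /cintegral !Rintegral_mkcondr.
congr (_ +i* _); apply: eq_Rintegral => x; rewrite inE => Ex; rewrite patchE; case: ifPn => //.
  by rewrite notin_setE => /(h0 _ Ex) ->.
by rewrite notin_setE => /(h0 _ Ex) ->.
Qed.

(** The only analytic input is that [Gamma zeta], [Gamma alpha] and
    [Gamma (zeta + alpha)] are nonzero, so that the constants cancel. *)
Lemma ratio_density_kober zeta alpha (f : R -> R) u :
  0 < complex.Re alpha -> 0 < complex.Re zeta -> 0 < u ->
  cintegrable `]0, u[ (kober_integrand zeta alpha f u) ->
  cintegrable `]0, +oo[ (ratio_integrand (beta1_density zeta alpha) f u) /\
  kober1 zeta alpha f u =
    Gamma zeta / Gamma (zeta + alpha) *
    ratio_density (beta1_density zeta alpha) f u.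
Proof.
move=> ha hz u0 ik.
set K := Gamma (zeta + alpha) / (Gamma zeta * Gamma alpha) * cpow u (- zeta - alpha).
have Kr : {in `]0, u[%classic, (fun v => K * kober_integrand zeta alpha f u v) =1
    ratio_integrand (beta1_density zeta alpha) f u}.
  by move=> v; rewrite inE/= in_itv/= => v0u; rewrite ratio_integrandE.
have sub : (`]0, u[%classic : set R) `<=` `]0, +oo[%classic.
  by apply: subset_itvl.
have r0 x : `]0, +oo[%classic x -> ~ `]0, u[%classic x ->
    ratio_integrand (beta1_density zeta alpha) f u x = 0.
  rewrite /= !in_itv/= andbT => -> /negP; rewrite -leNgt; exact: ratio_integrand0.
split.
  apply: (cintegrable_support _ _ sub r0) => //.
  by apply: eq_cintegrable Kr _ => //; exact: cintegrableZ.
rewrite /ratio_density (cintegral_support _ _ sub r0)// -(eq_cintegral Kr) cintegralZ//.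
rewrite /kober1 /K.
have gz := Gamma_neq0 hz; have ga := Gamma_neq0 ha.
have gza : Gamma (zeta + alpha) != 0.
  apply: Gamma_neq0.
  by case: (zeta) (alpha) hz ha => ? ? [? ?] /=; exact: addr_gt0.
by field; rewrite gz ga gza.
Qed.

End cintegral.

(** * Integrability of the Kober integrand for almost every u *)

Section kober_integrable.
Context {R : realType}.
Notation mu := (@lebesgue_measure R).
Notation pos := (`]0%R, +oo[%classic : set R).
Notation RR := (measurableTypeR R * measurableTypeR R)%type.

Lemma mem_pos (x : R) : (x \in pos) = (0 < x).
Proof. by apply/idP/idP; rewrite inE/= in_itv/= andbT. Qed.

Lemma patch_pos_ge0 (f : R -> R) x : (forall y, 0 < y -> 0 <= f y) ->
  0 <= (f \_ pos) x.
Proof.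
by move=> f0; rewrite patchE mem_pos; case: ifPn => // x0; exact: f0.
Qed.

Lemma measurable_patch_pos (h : R -> R) :
  measurable_fun pos h -> measurable_fun setT (h \_ pos).
Proof. by move=> mh; apply/(measurable_restrictT h (measurable_itv _)). Qed.

(** The convolution of two probability densities has total integral [1] by
    Tonelli, hence is finite almost everywhere. *)
Lemma ae_integrable_convolution (a : R) (f : R -> R) : 0 < a -> is_density f ->
  {ae mu, forall u : R, 0 < u ->
    mu.-integrable `]0, u[ (fun v => (loglogistic a (u - v) * f v)%:E)}.
Proof.
move=> a0 [mf f0 f1].
pose pk : R -> R := loglogistic a \_ pos; pose pf : R -> R := f \_ pos.
have mk : measurable_fun pos (loglogistic a).
  by apply/measurable_EFinP; exact: measurable_int (integrable_loglogistic a0).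
have mpk : measurable_fun setT pk by exact: measurable_patch_pos.
have mpf : measurable_fun setT pf by exact: measurable_patch_pos.
have pk0 t : 0 <= pk t.
  by apply: patch_pos_ge0 => x _; exact: loglogistic_ge0.
have pf0 t : 0 <= pf t by exact: patch_pos_ge0.
pose Phi (z : RR) := (pk (z.1 - z.2) * pf z.2)%:E.
have mPhi : measurable_fun setT Phi.
  have msub : measurable_fun setT (fun z : RR => (z.1 - z.2)%R).
    by apply: measurable_funB; [exact: measurable_fst|exact: measurable_snd].
  apply/measurable_EFinP; apply: measurable_funM.
    exact: measurableT_comp mpk msub.
  exact: measurableT_comp mpf measurable_snd.
have Phi0 z : (0 <= Phi z)%E by rewrite lee_fin mulr_ge0.
have tot : (\int[mu]_u \int[mu]_v Phi (u, v) = 1)%E.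
  rewrite (fubini_tonelli Phi mPhi Phi0).
  rewrite -f1 [RHS]integral_mkcond; apply: eq_integral => v _.
  have mpkv : measurable_fun setT (fun u : measurableTypeR R => (pk (u - v))%:E).
    apply/measurable_EFinP; apply: measurableT_comp mpk _.
    by apply: measurable_funB; [exact: measurable_id|exact: measurable_cst].
  transitivity ((pf v)%:E * \int[mu]_u (pk (u - v))%:E)%E.
    rewrite -ge0_integralZl//; last 2 first.
    - by move=> u _; rewrite lee_fin.
    - by rewrite lee_fin.
    by apply: eq_integral => u _; rewrite /Phi/= mulrC EFinM.
  rewrite [X in (_ * X)%E](_ : _ = 1%E).
    by rewrite mule1 /pf !patchE; case: ifP.
  rewrite -(integral_loglogistic v a0) [RHS]integral_mkcond; apply: eq_integral => u _.
  by rewrite /pk !patchE !mem_setE !in_itv/= !andbT subr_gt0; case: ifP.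
have iG : mu.-integrable setT (fun u => \int[mu]_v Phi (u, v))%E.
  apply/integrableP; split; first exact: measurable_fun_fubini_tonelli_F.
  under eq_integral do rewrite gee0_abs ?integral_ge0//.
  by rewrite tot ltry.
have := integrable_ae measurableT iG; apply: filterS => u /(_ I) ufin u0.
have iu : mu.-integrable setT (fun v => Phi (u, v)).
  apply/integrableP; split.
    exact: measurableT_comp mPhi (measurable_pair1 u).
  under eq_integral do rewrite gee0_abs//.
  by move: ufin; rewrite ge0_fin_numE ?integral_ge0.
have := @integrableS _ _ _ mu _ `]0, u[%classic _ measurableT
  (measurable_itv _) (@subsetT _ _) iu.
apply: eq_integrable => // v; rewrite inE/= in_itv/= => /andP[v0 vu].
by rewrite /Phi/= /pk /pf !patchE !mem_setE !in_itv/= !andbT subr_gt0 vu v0.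
Qed.

(** Polar form: for [0 < v < u] and [0 <= f v] the first factor is the modulus of
    the integrand. *)
Lemma kober_integrandE (zeta alpha : R[i]) (f : R -> R) (u v : R) :
  kober_integrand zeta alpha f u v =
  ((u - v) `^ (complex.Re alpha - 1) * v `^ complex.Re zeta * f v)%:C *
  (cos (complex.Im alpha * ln (u - v) + complex.Im zeta * ln v) +i*
   sin (complex.Im alpha * ln (u - v) + complex.Im zeta * ln v)).
Proof.
rewrite /kober_integrand !cpowE cisD !rmorphM/=.
by case: alpha => a b /=; rewrite subr0; ring.
Qed.

Lemma ae_kober_integrable (zeta alpha : R[i]) (f : R -> R) :
  0 < complex.Re alpha -> 0 < complex.Re zeta -> is_density f ->
  {ae mu, forall u : R, 0 < u ->
    cintegrable `]0, u[ (kober_integrand zeta alpha f u)}.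
Proof.
move=> ha hz hf; have := ae_integrable_convolution ha hf.
apply: (@filterS _ _ (ae_filter_ringOfSetsType mu)) => u /[swap] u0 /(_ u0) iu.
set a := complex.Re alpha in ha iu *; set z := complex.Re zeta in hz *.
case: hf => mf f0 _.
pose A v := (u - v) `^ (a - 1) * v `^ z * f v.
pose th v := complex.Im alpha * ln (u - v) + complex.Im zeta * ln v.
pose C := (1 + u `^ a) ^+ 2 / a * u `^ z.
(* [(1 + (u - v)^a)^2 <= (1 + u^a)^2] and [v^z <= u^z] yield the constant [C] *)
have hA v : 0 < v < u -> 0 <= A v <= C * (loglogistic a (u - v) * f v).
  move=> /andP[v0 vu]; have uv0 : 0 < u - v by rewrite subr_gt0.
  rewrite !mulr_ge0 ?powR_ge0 ?f0//= /A /C mulrA ler_wpM2r ?f0//.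
  have u0' := powR_ge0 u a; have uv0' := powR_ge0 (u - v) a.
  have h1 : (u - v) `^ a <= u `^ a.
    apply: ge0_ler_powR; rewrite ?nnegrE ?(ltW ha) ?(ltW uv0) ?(ltW u0)//.
    by rewrite gerBl ltW.
  have h2 : v `^ z <= u `^ z.
    by apply: ge0_ler_powR; rewrite ?nnegrE ?(ltW hz) ?(ltW v0) ?(ltW u0)// ltW.
  have h3 : 1 <= (1 + u `^ a) ^+ 2 / (1 + (u - v) `^ a) ^+ 2.
    rewrite ler_pdivlMr ?exprn_gt0 ?ltr_wpDr// mul1r.
    by rewrite lerXn2r ?nnegrE ?addr_ge0// lerD2l.
  have -> : (1 + u `^ a) ^+ 2 / a * u `^ z * loglogistic a (u - v) =
      (u - v) `^ (a - 1) *
        (((1 + u `^ a) ^+ 2 / (1 + (u - v) `^ a) ^+ 2) * u `^ z).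
    by rewrite /loglogistic; field; rewrite !gt_eqF ?exprn_gt0 ?ltr_wpDr.
  rewrite ler_wpM2l ?powR_ge0//; apply: (le_trans h2).
  by rewrite ler_peMl ?powR_ge0.
have mA : measurable_fun `]0, u[ A.
  apply: measurable_funM; last first.
    by apply: measurable_funS mf => //; exact: subset_itvl.
  apply: measurable_funM.
    apply: measurable_funTS.
    apply: (measurableT_comp (measurable_powR _)).
    by apply: measurable_funB; [exact: measurable_cst|exact: measurable_id].
  by apply: measurable_funTS; exact: measurable_powR.
have mth : measurable_fun setT th.
  apply: measurable_funD; apply: measurable_funM => //.
    apply: (measurableT_comp (@measurable_ln R)).
    by apply: measurable_funB; [exact: measurable_cst|exact: measurable_id].
have mcos : measurable_fun setT (@cos R).
  by apply: continuous_measurable_fun; exact: continuous_cos.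
have msin : measurable_fun setT (@sin R).
  by apply: continuous_measurable_fun; exact: continuous_sin.
have dom (s : R -> R) : measurable_fun setT s -> (forall x, `|s x| <= 1) ->
    mu.-integrable `]0, u[ (fun v => (A v * s (th v))%:E).
  move=> ms s1; apply: (@le_integrable _ _ _ mu _ _ _
    (fun v : R => C%:E * (loglogistic a (u - v) * f v)%:E)%E) => //.
  - apply/measurable_EFinP; apply: measurable_funM => //.
    by apply: measurable_funTS; exact: measurableT_comp ms mth.
  - move=> v /=; rewrite in_itv/= => /hA /andP[A0 AC]; rewrite lee_fin normrM.
    rewrite (ger0_norm A0) (le_trans (ler_piMr _ (s1 _)))// (le_trans AC)//.
    exact: ler_norm.
  - exact: integrableZl.
split.
  apply: eq_integrable (dom _ mcos (@cos_max R)) => // v _.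
  by rewrite kober_integrandE /= mul0r subr0.
apply: eq_integrable (dom _ msin (@sin_max R)) => // v _.
by rewrite kober_integrandE /= mul0r addr0.
Qed.

End kober_integrable.

(** * Integration against a measure with a density *)

Section density.
Context {R : realType}.

Import HBNNSimple.
Local Open Scope ereal_scope.

Lemma nnsfun_integral_density d (T : measurableType d)
    (mu nu : {measure set T -> \bar R}) (w : T -> R) :
  measurable_fun setT w -> (forall x, (0 <= w x)%R) ->
  (forall A, measurable A -> nu A = \int[mu]_(x in A) (w x)%:E) ->
  forall g : {nnsfun T >-> R},
  \int[nu]_x (g x)%:E = \int[mu]_x ((g x)%:E * (w x)%:E).
Proof.
move=> mw w0 nuE g; rewrite integralT_nnsfun sintegralE.
have gE x : (g x)%:E * (w x)%:E =
    \sum_(r \in range g) r%:E * (((EFin \o w) \_ (g @^-1` [set r])) x).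
  rewrite {1}(fimfunE g x) -fsumEFin// ge0_mule_fsuml; last first.
    by move=> r; exact: nnfun_muleindic_ge0.
  apply: eq_fsbigr => r _; rewrite EFinM -muleA patchE indicE.
  by case: ifP => _; rewrite ?mul1e ?mul0e ?mule0.
have mgr r : measurable (g @^-1` [set r]) by exact: measurable_sfunP.
have mwr r : measurable_fun setT ((EFin \o w) \_ (g @^-1` [set r])).
  apply/(measurable_restrictT _ (mgr r)); apply: measurable_funTS.
  exact/measurable_EFinP.
have wr0 r x : 0 <= ((EFin \o w) \_ (g @^-1` [set r])) x.
  by rewrite patchE; case: ifP => // _; rewrite lee_fin.
under [RHS]eq_integral do rewrite gE.
rewrite ge0_integral_fsum//; last 2 first.
- by move=> r; apply: emeasurable_funM.
- move=> r x _; have [r0|r0] := leP 0%R r; first by rewrite mule_ge0.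
  by rewrite patchE preimage_nnfun0// in_set0 mule0.
apply: eq_fsbigr => r; rewrite inE => -[x _ <-].
rewrite ge0_integralZl//; first by rewrite nuE// integral_mkcond.
by rewrite lee_fin.
Qed.

Lemma ge0_integral_density d (T : measurableType d)
    (mu nu : {measure set T -> \bar R}) (w : T -> R) :
  measurable_fun setT w -> (forall x, (0 <= w x)%R) ->
  (forall A, measurable A -> nu A = \int[mu]_(x in A) (w x)%:E) ->
  forall h : T -> \bar R, measurable_fun setT h -> (forall x, 0 <= h x) ->
  \int[nu]_x h x = \int[mu]_x (h x * (w x)%:E).
Proof.
move=> mw w0 nuE h mh h0.
pose g := nnsfun_approx measurableT mh.
have gh x : (g n x)%:E @[n --> \oo] --> h x by exact: cvg_nnsfun_approx.
have g0 n x : 0 <= (g n x)%:E by rewrite lee_fin.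
have ndg x : nondecreasing_seq (fun n => (g n x)%:E).
  by move=> m n mn; rewrite lee_fin; exact/lefP/nd_nnsfun_approx.
have mg n : measurable_fun setT (fun x => (g n x)%:E) by exact/measurable_EFinP.
have gwh x : (g n x)%:E * (w x)%:E @[n --> \oo] --> h x * (w x)%:E.
  exact: cvgeZr.
have c1 : \int[nu]_x (g n x)%:E @[n --> \oo] --> \int[nu]_x h x.
  rewrite (_ : \int[nu]_x h x = \int[nu]_x limn (fun n => (g n x)%:E)).
    exact: cvg_monotone_convergence.
  by apply: eq_integral => x _; apply/esym/cvg_lim.
have c2 : \int[mu]_x ((g n x)%:E * (w x)%:E) @[n --> \oo] -->
    \int[mu]_x (h x * (w x)%:E).
  rewrite (_ : \int[mu]_x (h x * (w x)%:E) =
      \int[mu]_x limn (fun n => (g n x)%:E * (w x)%:E)).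
    apply: cvg_monotone_convergence => //.
    - by move=> n; apply: emeasurable_funM => //; exact/measurable_EFinP.
    - by move=> n x _; rewrite mule_ge0// lee_fin.
    - by move=> x _ m n mn; rewrite lee_wpmul2r ?lee_fin//; exact: ndg.
  by apply: eq_integral => x _; apply/esym/cvg_lim.
apply: (cvg_unique _ c1) => //; apply: cvg_trans c2.
by under eq_fun do rewrite (nnsfun_integral_density mw w0 nuE).
Qed.

End density.

(** * The substitution x = y / u on the positive half-line *)

Section inversion.
Context {R : realType}.
Notation mu := (@lebesgue_measure R).
Notation pos := (`]0%R, +oo[%classic : set R).

(** Writing [u^-1] as [u * (u^2)^(-1)] with a real power of a nonnegative base
    reduces the claim to the measurability of real powers; it also holds at
    [u = 0]. *)
Lemma measurable_inv : measurable_fun setT (@GRing.inv R).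
Proof.
rewrite (_ : GRing.inv = fun u : R => u * (u ^+ 2) `^ (- 1)).
  apply: measurable_funM => //.
  apply: (measurableT_comp (measurable_powR _)); exact: exprn_measurable.
apply/funext => u; rewrite powR_inv1 ?sqr_ge0//.
have [->|u0] := eqVneq u 0; first by rewrite invr0 mul0r.
by rewrite expr2 invfM mulVKf.
Qed.

Definition inversion_density (y : R) : R -> R := (fun u => y / u ^+ 2) \_ pos.

Lemma measurable_inversion_density y : measurable_fun setT (inversion_density y).
Proof.
apply: measurable_patch_pos; apply: measurable_funTS; apply: measurable_funM => //.
apply: (measurableT_comp measurable_inv); exact: exprn_measurable.
Qed.

Lemma inversion_density_ge0 y u : 0 <= y -> 0 <= inversion_density y u.
Proof.
move=> y0; rewrite /inversion_density patchE; case: ifP => // _.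
by rewrite divr_ge0// sqr_ge0.
Qed.

Lemma integral_inversion_density (y q : R) : 0 < y -> 0 < q ->
  (\int[mu]_(u in `](y / q)%R, +oo[) (y / u ^+ 2)%:E = q%:E)%E.
Proof.
move=> y0 q0; have yq0 : 0 < y / q by rewrite divr_gt0.
have pos_of (u : R) : y / q < u -> 0 < u by exact: lt_trans.
have dF (u : R) : 0 < u -> is_derive u 1 (fun u => - (y / u)) (y / u ^+ 2).
  move=> u0; have un0 : u != 0 by rewrite gt_eqF.
  have dV := @is_deriveV _ id u _ _ un0 (is_derive_id u 1).
  apply: (is_derive1_congr (is_deriveN (@is_deriveZ _ _ _ _ y u 1 _ dV))) => //.
  by rewrite /GRing.scale/=; field.
rewrite (_ : q%:E = (0 - - (y / (y / q)))%:E); last first.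
  by rewrite sub0r opprK invf_div mulrCA divff ?gt_eqF// mulr1.
apply: (@ge0_FTC_oy _ _ (fun u => - (y / u))).
- by move=> u uyq; rewrite divr_ge0 ?sqr_ge0// ltW.
- move=> u /pos_of u0; apply: continuousM; first exact: cst_continuous.
  have cu : {for u, continuous (fun x : R => x)} by exact: cvg_id.
  by apply: continuousV; [rewrite expf_neq0// gt_eqF|exact: (continuousM cu cu)].
- by move=> u /pos_of; exact: dF.
- rewrite -oppr0; apply: cvgN; rewrite -(mulr0 y); apply: cvgM; first exact: cvg_cst.
  apply/gtr0_cvgV0; last exact: cvg_id.
  exact: nbhs_pinfty_gt.
- by apply: cvg_at_right_filter; exact: is_derive_continuous (dF _ yq0).
Qed.

(** Lebesgue measure on the positive half-line is the image under [u |-> y / u] of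
    the measure with density [y / u^2].  Both give mass [max q 0] to each ray
    [(-oo, q)], and these rays determine a measure that is finite on them.  This
    covers an arbitrary measurable [h], in particular one multiplied by the
    indicator of a Borel set. *)
Lemma ge0_integral_inversion (y : R) (h : R -> \bar R) : 0 < y ->
  measurable_fun setT h -> (forall x, 0 <= h x)%E ->
  (\int[mu]_(x in pos) h x =
   \int[mu]_(u in pos) (h (y / u)%R * (y / u ^+ 2)%:E))%E.
Proof.
move=> y0 mh h0; pose w := inversion_density y.
have mw := measurable_inversion_density y.
have w0 u : 0 <= w u by apply: inversion_density_ge0; exact: ltW.
have mEw : measurable_fun setT (EFin \o w) by exact/measurable_EFinP.
pose nu (A : set (measurableTypeR R)) := (\int[mu]_(u in A) (w u)%:E)%E.
have nu0 : nu set0 = 0%E by exact: integral_set0.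
have nuge0 A : (0 <= nu A)%E by apply: integral_ge0 => u _; rewrite lee_fin.
have nuS : semi_sigma_additive nu.
  have Ew0 u : (0 <= (EFin \o w) u)%E by rewrite lee_fin.
  exact: (@semi_sigma_additive_nng_induced _ _ _ mu _ mEw Ew0).
pose nuM := isMeasure.Build _ _ _ nu nu0 nuge0 nuS.
pose NU : {measure set (measurableTypeR R) -> \bar R} := HB.pack nu nuM.
pose psi (u : measurableTypeR R) : measurableTypeR R := y / u.
have mpsi : measurable_fun setT psi.
  by apply: measurable_funM => //; exact: measurable_inv.
pose m1 : {measure set (measurableTypeR R) -> \bar R} :=
  mrestr mu (measurable_itv `]0, +oo[).
have [m2 m2E] : exists m2 : {measure set (measurableTypeR R) -> \bar R},
    m2 = pushforward NU psi :> (_ -> _).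
  pose m2 : {measure set (measurableTypeR R) -> \bar R} := pushforward NU psi.
  by exists (m2 mpsi).
have m1_ray q : m1 `]-oo, q[%classic = (Num.max q 0)%:E.
  rewrite /m1 /= /mrestr.
  rewrite (_ : _ `&` _ = `]0, q[%classic); last first.
    apply/seteqP; split=> x /=; rewrite !in_itv/= andbT.
      by case=> -> ->.
    by case/andP.
  rewrite lebesgue_measure_itv/= lte_fin; case: ltP => // q0.
  by rewrite sube0.
have m2_ray q : m2 `]-oo, q[%classic = (Num.max q 0)%:E.
  rewrite m2E /pushforward.
  rewrite (_ : NU _ = \int[mu]_(u in psi @^-1` `]-oo, q[) (w u)%:E)%E//.
  rewrite integral_mkcond.
  have [q0|q0] := leP q 0.
    apply: integral0_eq => u _; rewrite patchE; case: ifP => //.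
    rewrite inE/= in_itv/= /psi => uq; rewrite /w /inversion_density patchE.
    case: ifP => //; rewrite inE/= in_itv/= andbT => u0.
    by move: (lt_le_trans uq q0); rewrite ltNge divr_ge0// ltW.
  rewrite -(integral_inversion_density y0 q0) [RHS]integral_mkcond.
  apply: eq_integral => u _.
  have uE : (u \in psi @^-1` `]-oo, q[%classic) = (y / u < q).
    by apply/idP/idP; rewrite inE/= in_itv/=.
  rewrite !patchE uE /w /inversion_density patchE.
  rewrite !mem_setE /= !in_itv/= !andbT /psi.
  have [u0|u0] := ltP 0 u; last first.
    have -> : (y / q < u) = false.
      by apply/negbTE; rewrite -leNgt (le_trans u0)// ltW// divr_gt0.
    by case: ifP.
  by rewrite !ltr_pdivrMr// [u * q]mulrC.
have m12 A : measurable A -> m1 A = m2 A.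
  move=> mA; apply: (@measure_unique _ R (measurableTypeR R) (@RGenInftyO.G R)
    (fun n => `]-oo, n%:R[%classic) _ _ _ _ m1 m2) => //.
  - exact: RGenInftyO.measurableE.
  - move=> _ _ [a ->] [b ->]; exists (Num.min a b).
    by apply/seteqP; split=> x /=; rewrite !in_itv/= lt_min => /andP.
  - by move=> n; exists n%:R.
  - rewrite -subTset => x _; exists (Num.bound `|x|) => //=.
    by rewrite in_itv/= (le_lt_trans (ler_norm _))// archi_boundP.
  - by move=> _ [q ->]; rewrite m1_ray m2_ray.
  - by move=> n; rewrite m1_ray ltry.
have munE A : measurable A -> A `<=` pos -> mu A = m2 A.
  by move=> mA Apos; rewrite -m12// /m1/= /mrestr setIidl.
rewrite (eq_measure_integral m2); last by move=> A mA Apos; exact: munE.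
rewrite integral_mkcond.
have mhp : measurable_fun setT (h \_ pos).
  by apply/(measurable_restrictT _ (measurable_itv _)); exact: measurable_funTS.
have hp0 x : (0 <= (h \_ pos) x)%E by rewrite patchE; case: ifP.
transitivity (\int[NU]_u ((h \_ pos) \o psi) u)%E.
  rewrite -(@ge0_integral_pushforward _ _ _ _ _ _ mpsi NU setT)//.
  by apply: eq_measure_integral => A mA _; rewrite m2E.
have mhpsi : measurable_fun setT ((h \_ pos) \o psi).
  exact: measurableT_comp mhp mpsi.
rewrite (@ge0_integral_density _ _ _ mu NU w mw w0 _ _ mhpsi
  (fun u => hp0 (psi u)))//.
rewrite [RHS]integral_mkcond; apply: eq_integral => u _.
rewrite /w /inversion_density /= /psi !patchE !mem_setE/= !in_itv/= !andbT.
by have [u0|u0] := ltP 0 u; [rewrite divr_gt0|rewrite mule0].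
Qed.

End inversion.

(** * The law of the ratio of two independent positive variables *)

Section ratio_law.
Context {R : realType}.
Notation mu := (@lebesgue_measure R).
Notation pos := (`]0%R, +oo[%classic : set R).
Notation RR := (measurableTypeR R * measurableTypeR R)%type.

(** Extending both densities by zero makes the kernel nonnegative and measurable
    on the whole plane, as Tonelli's theorem requires. *)
Definition ratio_kernel (f1 f2 : R -> R) (z : R * R) : R :=
  (f1 \_ pos) (z.2 / z.1) * ((f2 \_ pos) z.2 * (z.2 / z.1 ^+ 2)).

Lemma ratio_kernel_ge0 (f1 f2 : R -> R) z :
  (forall x, 0 < x -> 0 <= f1 x) -> (forall x, 0 < x -> 0 <= f2 x) ->
  0 <= ratio_kernel f1 f2 z.
Proof.
move=> f10 f20; rewrite /ratio_kernel mulr_ge0 ?patch_pos_ge0//.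
rewrite patchE mem_pos; case: ifPn => [z0|_]; last by rewrite mul0r.
by rewrite mulr_ge0 ?f20// divr_ge0 ?sqr_ge0// ltW.
Qed.

Lemma measurable_ratio_kernel (f1 f2 : R -> R) :
  measurable_fun pos f1 -> measurable_fun pos f2 ->
  measurable_fun [set: RR] (ratio_kernel f1 f2).
Proof.
move=> /measurable_patch_pos mf1 /measurable_patch_pos mf2.
have mq : measurable_fun setT
    (fun z : RR => (z.2 / z.1)%R).
  apply: measurable_funM; first exact: measurable_snd.
  exact: measurableT_comp measurable_inv measurable_fst.
apply: measurable_funM; first exact: measurableT_comp mf1 mq.
apply: measurable_funM; first exact: measurableT_comp mf2 measurable_snd.
apply: measurable_funM; first exact: measurable_snd.
apply: measurableT_comp measurable_inv _.
by apply: measurable_funX; exact: measurable_fst.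
Qed.

Lemma integral_ratio_kernel (f1 f2 : R -> R) (u : R) : 0 < u ->
  (\int[mu]_v (ratio_kernel f1 f2 (u, v))%:E =
   \int[mu]_(v in pos) (f1 (v / u) * (f2 v * (v / u ^+ 2)))%:E)%E.
Proof.
move=> u0; rewrite [RHS]integral_mkcond; apply: eq_integral => v _.
rewrite /ratio_kernel/= !patchE !mem_pos.
by have [v0|v0] := ltP 0 v; [rewrite divr_gt0|rewrite mul0r mulr0].
Qed.

(** Conditionally on [x2 = y > 0], the event reads [y / x1 \in B]; the
    substitution [x = y / u] gives it probability
    [int_(u in B) f1 (y / u) y / u^2 du].  Independence allows integrating this
    against the law of [x2], and Tonelli exchanges the two integrals. *)
Lemma law_ratio d (T : measurableType d) (P : probability T R)
    (x1 x2 : T -> R) (f1 f2 : R -> R) :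
  has_density P x1 f1 -> has_density P x2 f2 -> independent2 P x1 x2 ->
  forall B : set R, measurable B ->
  P ((fun t => x2 t / x1 t) @^-1` B) =
  (\int[mu]_(u in B `&` pos) \int[mu]_(v in pos)
     (f1 (v / u) * (f2 v * (v / u ^+ 2)))%:E)%E.
Proof.
move=> [mx1 [mf1 f10 _] law1] [mx2 [mf2 f20 _] law2] ind B mB.
pose x1' : T -> measurableTypeR R := x1; pose x2' : T -> measurableTypeR R := x2.
pose mX1 := isMeasurableFun.Build _ _ _ _ x1' mx1.
pose mX2 := isMeasurableFun.Build _ _ _ _ x2' mx2.
pose X1 : {mfun T >-> measurableTypeR R} := HB.pack x1' mX1.
pose X2 : {mfun T >-> measurableTypeR R} := HB.pack x2' mX2.
pose P1 : probability (measurableTypeR R) R := distribution P X1.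
pose P2 : probability (measurableTypeR R) R := distribution P X2.
pose pf1 : R -> R := f1 \_ pos; pose pf2 : R -> R := f2 \_ pos.
have mpf1 : measurable_fun setT pf1 by exact: measurable_patch_pos.
have mpf2 : measurable_fun setT pf2 by exact: measurable_patch_pos.
have pf10 x : 0 <= pf1 x by exact: patch_pos_ge0.
have pf20 x : 0 <= pf2 x by exact: patch_pos_ge0.
pose q (z : RR) : measurableTypeR R := (z.1 / z.2)%R.
have mq : measurable_fun setT q.
  apply: measurable_funM; first exact: measurable_fst.
  exact: measurableT_comp measurable_inv measurable_snd.
pose S := q @^-1` B.
have mS : measurable S by rewrite -[S]setTI; exact: mq.
pose x21 t : RR := (x2 t, x1 t).
have mx21 : measurable_fun setT x21 by apply/measurable_fun_pairP; split.
have [J JE] : exists J : {measure set RR -> \bar R},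
    J = pushforward P x21 :> (_ -> _).
  pose J : {measure set RR -> \bar R} := pushforward P x21.
  by exists (J mx21).
(* by independence the joint law of [(x2, x1)] is the product [P2 \x P1] *)
have joint : (P2 \x P1)%E S = P (x21 @^-1` S).
  transitivity (J S); last by rewrite JE.
  apply: product_measure_unique => // A1 A2 mA1 mA2.
  rewrite JE /pushforward [RHS]muleC -[RHS]ind//; congr (P _).
  by apply/seteqP; split => t [].
rewrite [LHS](_ : _ = P (x21 @^-1` S))// -joint.
(* [K y] is the conditional probability of the event given [x2 = y] *)
pose K y := P1 (xsection S y).
rewrite [LHS](_ : _ = \int[P2]_y K y)%E//.
have mK : measurable_fun setT K by exact: measurable_fun_xsection.
have K0 y : (0 <= K y)%E by exact: measure_ge0.
have P2E A : measurable A -> P2 A = (\int[mu]_(x in A) (pf2 x)%:E)%E.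
  move=> mA; rewrite [LHS](law2 A mA) integral_mkcondr; apply: eq_integral => x _.
  by rewrite /pf2 !patchE; case: ifP.
rewrite (@ge0_integral_density _ _ _ mu P2 pf2 mpf2 pf20 P2E K mK K0).
pose Psi (z : RR) :=
  (\1_(B `&` pos) z.1 * ratio_kernel f1 f2 z)%:E.
have Psi0 z : (0 <= Psi z)%E by rewrite lee_fin mulr_ge0// ratio_kernel_ge0.
have mPsi : measurable_fun setT Psi.
  have mBp : measurable_fun setT (\1_(B `&` pos) : measurableTypeR R -> R).
    by apply: measurable_indic; apply: measurableI.
  apply/measurable_EFinP; apply: measurable_funM.
    exact: measurableT_comp mBp measurable_fst.
  exact: measurable_ratio_kernel.
transitivity (\int[mu]_y \int[mu]_u Psi (u, y))%E.
  apply: eq_integral => y _.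
  have [y0|y0] := leP y 0.
    have -> : pf2 y = 0.
      by rewrite /pf2 patchE mem_pos ltNge y0.
    rewrite mule0; apply/esym/integral0_eq => u _.
    rewrite /Psi/ratio_kernel/= [(f2 \_ pos) y]patchE mem_pos ltNge y0/=.
    by rewrite mul0r !mulr0.
  pose h x := (\1_B (y / x) * pf1 x)%:E.
  have mh : measurable_fun setT h.
    apply/measurable_EFinP; apply: measurable_funM => //.
    have mB1 : measurable_fun setT (\1_B : measurableTypeR R -> R).
      exact: measurable_indic.
    apply: measurableT_comp mB1 _.
    by apply: measurable_funM => //; exact: measurable_inv.
  have h0 x : (0 <= h x)%E by rewrite lee_fin mulr_ge0.
  have -> : K y = (\int[mu]_(x in pos) h x)%E.
    have mA : measurable (xsection S y : set (measurableTypeR R)).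
      exact: measurable_xsection.
    rewrite [LHS](law1 _ mA) integral_mkcondl; apply: eq_integral => x xpos.
    rewrite /h /pf1 !patchE xpos indicE.
    have -> : (x \in xsection S y) = (y / x \in B).
      by rewrite mem_xsection; apply/idP/idP; rewrite !inE.
    by case: ifP => _; rewrite ?mul1r ?mul0r.
  rewrite (ge0_integral_inversion y0 mh h0) integral_mkcond -ge0_integralZr//.
  - apply: eq_integral => u _.
    rewrite patchE mem_pos /Psi /ratio_kernel/=.
    have [u0|u0] := ltP 0 u; last first.
      by rewrite indicE in_setI mem_pos ltNge u0 andbF !mul0e mul0r.
    have yyu : y / (y / u) = u by rewrite invf_div mulrCA divff ?gt_eqF// mulr1.
    rewrite /h -!EFinM yyu !indicE in_setI mem_pos u0 andbT.
    by rewrite /pf1 /pf2; congr (_%:E); ring.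
  - apply/(measurable_restrictT _ (measurable_itv _)); apply: measurable_funTS.
    apply: emeasurable_funM.
      apply: (measurableT_comp mh).
      by apply: measurable_funM => //; exact: measurable_inv.
    apply/measurable_EFinP; apply: measurable_funM => //.
    by apply: (measurableT_comp measurable_inv); exact: exprn_measurable.
  - move=> u _; rewrite patchE; case: ifP => // _.
    by rewrite mule_ge0// lee_fin divr_ge0 ?sqr_ge0// ltW.
  - by rewrite lee_fin.
transitivity (\int[mu]_u \int[mu]_y Psi (u, y))%E.
  exact/esym/(@fubini_tonelli _ _ _ _ R mu mu Psi mPsi Psi0).
rewrite [RHS]integral_mkcond.
apply: eq_integral => u _; rewrite patchE; case: ifPn => uB.
  move: (uB); rewrite inE => -[_]; rewrite /= in_itv/= andbT => u0.
  rewrite -integral_ratio_kernel//; apply: eq_integral => v _.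
  by rewrite /Psi/= indicE uB mul1r.
apply: integral0_eq => v _; rewrite /Psi/= indicE.
by rewrite (negbTE uB) mul0r.
Qed.

(** [law_ratio] computes with extended-real inner integrals [G u]; since the outer
    integral is [1], [G] is finite almost everywhere and may be replaced by its
    real value. *)
Lemma has_density_ratio d (T : measurableType d) (P : probability T R)
    (x1 x2 : T -> R) (f1 f2 : R -> R) :
  has_density P x1 f1 -> has_density P x2 f2 -> independent2 P x1 x2 ->
  has_density P (fun t => x2 t / x1 t)
    (fun u => \int[mu]_(v in pos) (f1 (v / u) * (f2 v * (v / u ^+ 2)))).
Proof.
move=> d1 d2 ind; have law := law_ratio d1 d2 ind.
case: d1 d2 => [mx1 [mf1 f10 _] _] [mx2 [mf2 f20 _] _].
pose G u := (\int[mu]_(v in pos) (f1 (v / u) * (f2 v * (v / u ^+ 2)))%:E)%E.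
have G0 u : 0 < u -> (0 <= G u)%E.
  move=> u0; rewrite /G -integral_ratio_kernel//; apply: integral_ge0 => v _.
  by rewrite lee_fin ratio_kernel_ge0.
have mG : measurable_fun pos G.
  have mF : measurable_fun setT
      (fun u => \int[mu]_v (ratio_kernel f1 f2 (u, v))%:E)%E.
    apply: (@measurable_fun_fubini_tonelli_F _ _ _ _ R mu
      (EFin \o ratio_kernel f1 f2)).
      by apply/measurable_EFinP; exact: measurable_ratio_kernel.
    by move=> z; rewrite lee_fin ratio_kernel_ge0.
  apply: eq_measurable_fun (measurable_funTS mF) => u; rewrite mem_pos => u0.
  exact: integral_ratio_kernel.
have totG : (\int[mu]_(u in pos) G u = 1)%E.
  have := law setT measurableT; rewrite preimage_setT probability_setT setTI.
  by move=> <-.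
have iG : mu.-integrable pos G.
  apply/integrableP; split=> //.
  rewrite (_ : integral _ _ _ = 1%E) ?ltry// -totG; apply: eq_integral => u.
  by rewrite mem_pos => u0; rewrite gee0_abs// G0.
have aeG : ae_eq mu pos G (fun u => (fine (G u))%:E).
  have := @integrable_ae _ _ _ mu _ (measurable_itv _) _ iG.
  by apply: (@filterS _ _ (ae_filter_ringOfSetsType mu)) => u fG /fG /fineK.
have mfG : measurable_fun pos (fine \o G) by exact: measurableT_comp.
have GE A : measurable A -> A `<=` pos ->
    (\int[mu]_(u in A) G u = \int[mu]_(u in A) (fine (G u))%:E)%E.
  move=> mA Apos; apply: ae_eq_integral => //.
  - exact: measurable_funS mG.
  - by apply/measurable_EFinP; exact: measurable_funS mfG.
  - exact: ae_eq_subset aeG.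
split.
- apply: measurable_funM => //; exact: measurableT_comp measurable_inv mx1.
- split=> //.
  + by move=> u u0; apply: fine_ge0; exact: G0.
  + by rewrite -totG GE.
- by move=> B mB; rewrite law// GE//; exact: measurableI.
Qed.

Lemma has_density_unique d (T : measurableType d) (P : probability T R)
    (x : T -> R) (f g : R -> R) :
  has_density P x f -> has_density P x g ->
  {ae mu, forall u : R, 0 < u -> f u = g u}.
Proof.
move=> [_ [mf f0 f1] lawf] [_ [mg _ _] lawg].
have fi : mu.-integrable pos (EFin \o f).
  apply/integrableP; split; first exact/measurable_EFinP.
  rewrite (_ : integral _ _ _ = 1%E) ?ltry// -f1; apply: eq_integral => u.
  by rewrite mem_pos => u0; rewrite /= ger0_norm// f0.
have mEg : measurable_fun pos (EFin \o g) by exact/measurable_EFinP.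
have : ae_eq mu pos (EFin \o f) (EFin \o g).
  apply: integral_ae_eq => // A Apos mA.
  by have := lawf A mA; rewrite lawg// (setIidl Apos) => ->.
apply: (@filterS _ _ (ae_filter_ringOfSetsType mu)) => u fg u0.
by apply: EFin_inj; apply: fg; rewrite /= in_itv/= andbT.
Qed.

End ratio_law.

(** * Real parameters *)

Section real_parameters.
Context {R : realType}.
Notation mu := (@lebesgue_measure R).
Implicit Types z w : R[i].

Lemma Im_mul_eq0 z w : complex.Im z = 0 -> complex.Im w = 0 ->
  complex.Im (z * w) = 0.
Proof. by case: z w => [a b] [c d] /= -> ->; rewrite mulr0 mul0r addr0. Qed.

Lemma Im_inv_eq0 z : complex.Im z = 0 -> complex.Im z^-1 = 0.
Proof. by case: z => a b /= ->; rewrite mul0r oppr0. Qed.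

Lemma Im_cpow x w : complex.Im w = 0 -> complex.Im (cpow x w) = 0.
Proof. by move=> w0; rewrite /cpow/= w0 mul0r sin0 mulr0. Qed.

Lemma Im_Gamma z : complex.Im z = 0 -> complex.Im (Gamma z) = 0.
Proof.
case: z => a b b0; rewrite Gamma_waveE/= /gamma_wave; move: b0 => /= ->.
have -> : gamma_integrand a 0 0 1 = cst 0.
  apply/funext => t; rewrite /gamma_integrand /wave !mul0r sin0.
  by rewrite mulr0 addr0 mulr0 mul0r.
by rewrite /Rintegral integral0.
Qed.

Lemma Im_beta1_density zeta alpha (x : R) :
  complex.Im zeta = 0 -> complex.Im alpha = 0 ->
  complex.Im (beta1_density zeta alpha x) = 0.
Proof.
move=> hz ha; rewrite /beta1_density; case: ifP => // _.
have ImB1 w : complex.Im w = 0 -> complex.Im (w - 1) = 0.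
  by case: w => a b /= ->; rewrite subr0.
have hza : complex.Im (zeta + alpha) = 0.
  by case: (zeta) (alpha) hz ha => [a b] [c d] /= -> ->; rewrite addr0.
by do ![apply: Im_mul_eq0 | apply: Im_inv_eq0 | apply: Im_Gamma
  | apply: Im_cpow]; auto.
Qed.

Lemma Re_ratio_density (f1 : R -> R[i]) (f : R -> R) (u : R) :
  complex.Re (ratio_density f1 f u) =
  \int[mu]_(v in `]0, +oo[) (complex.Re (f1 (v / u)) * (f v * (v / u ^+ 2))).
Proof.
rewrite /ratio_density /cintegral/=; apply: eq_Rintegral => v _.
by rewrite /ratio_integrand; case: (f1 _) => a b /=; rewrite mulr0 subr0.
Qed.

Lemma Im_ratio_density (f1 : R -> R[i]) (f : R -> R) (u : R) :
  (forall x, complex.Im (f1 x) = 0) -> complex.Im (ratio_density f1 f u) = 0.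
Proof.
move=> f10; rewrite /ratio_density /cintegral/= /Rintegral.
rewrite integral0_eq// => v _.
rewrite /ratio_integrand; have := f10 (v / u); case: (f1 _) => a b /= ->.
by rewrite mulr0 mul0r addr0.
Qed.

End real_parameters.

Theorem theorem2p1 (R : realType) (alpha zeta : R[i])
    (halpha : 0 < complex.Re alpha) (hzeta : 0 < complex.Re zeta)
    (f : R -> R) (hf : is_density f) :
  (* complex parameters: g is given by the usual formula *)
  {ae @lebesgue_measure R, forall u : R, 0 < u ->
    [/\ cintegrable `]0, u[ (kober_integrand zeta alpha f u),
        cintegrable `]0, +oo[
          (ratio_integrand (beta1_density zeta alpha) f u) &
        kober1 zeta alpha f u =
        Gamma zeta / Gamma (zeta + alpha) *
        ratio_density (beta1_density zeta alpha) f u]} /\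
  (* real parameters: g is the probability density of x2 / x1 *)
  (complex.Im alpha = 0 -> complex.Im zeta = 0 ->
   forall (d : measure_display) (T : measurableType d) (P : probability T R)
     (x1 x2 : T -> R),
   has_density P x1 (fun x => complex.Re (beta1_density zeta alpha x)) ->
   has_density P x2 f ->
   independent2 P x1 x2 ->
   has_density P (fun t => x2 t / x1 t)
     (fun u => complex.Re (ratio_density (beta1_density zeta alpha) f u)) /\
   forall g : R -> R,
     has_density P (fun t => x2 t / x1 t) g ->
     {ae @lebesgue_measure R, forall u : R, 0 < u ->
       kober1 zeta alpha f u =
       Gamma zeta / Gamma (zeta + alpha) * (g u)%:C}).
Proof.
have part1 : {ae @lebesgue_measure R, forall u : R, 0 < u ->
    [/\ cintegrable `]0, u[ (kober_integrand zeta alpha f u),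
        cintegrable `]0, +oo[
          (ratio_integrand (beta1_density zeta alpha) f u) &
        kober1 zeta alpha f u =
        Gamma zeta / Gamma (zeta + alpha) *
        ratio_density (beta1_density zeta alpha) f u]}.
  have := ae_kober_integrable halpha hzeta hf.
  apply: (@filterS _ _ (ae_filter_ringOfSetsType _)) => u + u0.
  move=> /(_ u0) ik.
  by have [] := ratio_density_kober halpha hzeta u0 ik.
split=> // ia iz d T P x1 x2 d1 d2 ind.
have dr : has_density P (fun t => x2 t / x1 t)
    (fun u => complex.Re (ratio_density (beta1_density zeta alpha) f u)).
  rewrite (funext (Re_ratio_density (beta1_density zeta alpha) f)).
  exact: (has_density_ratio d1 d2 ind).
split=> // g dg.
move: part1 (has_density_unique dr dg).
apply: (@filterS2 _ _ (ae_filter_ringOfSetsType _)) => u h1 h2 u0.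
have [_ _ ->] := h1 u0; rewrite -h2//; congr (_ * _).
have := Im_ratio_density f u (fun x => Im_beta1_density x iz ia).
by case: (ratio_density _ _ _) => a b /= ->.
Qed.
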